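(* Let $k\ge1$, let $\mathcal{E}_k$ be a complex separable Hilbert space, and let $J_k$ be the truncated shift of index $k$ on $\mathbb{E}_k=\mathcal{E}_k\otimes\mathbb{C}^k$, identified with $H^2_{\mathcal{E}_k}(\mathbb{D})\ominus z^kH^2_{\mathcal{E}_k}(\mathbb{D})$. A closed subspace $\mathcal{M}$ of $\mathbb{E}_k$ is invariant under $J_k$ if and only if there exist a Hilbert space $\mathcal{F}_k$ isomorphic to $\mathcal{E}_k$ and inner functions $\Theta\in H^\infty_{\mathcal{B}(\mathcal{F}_k,\mathcal{E}_k)}$ and $\Phi\in H^\infty_{\mathcal{B}(\mathcal{E}_k,\mathcal{F}_k)}$ such that $T_\Theta T_\Phi=M_{z^k}^{\mathcal{E}_k}$ and $\mathcal{M}=T_\Theta\big(\mathcal{N}(T_\Phi^* )\big)$.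
   Context: $\mathcal{N}(\cdot)$ denotes kernel. $H^2_{\mathcal{E}}(\mathbb{D})$ is the $\mathcal{E}$-valued Hardy space on the open unit disc $\mathbb{D}$; $H^\infty_{\mathcal{B}(\mathcal{E},\mathcal{F})}$ is the space of bounded analytic $\mathcal{B}(\mathcal{E},\mathcal{F})$-valued functions on $\mathbb{D}$. For $\Phi\in H^\infty_{\mathcal{B}(\mathcal{E},\mathcal{F})}$, $T_\Phi:H^2_{\mathcal{E}}(\mathbb{D})\to H^2_{\mathcal{F}}(\mathbb{D})$ is the analytic Toeplitz operator $T_\Phi h=\Phi h$; $\Phi$ is inner if $\Phi(e^{it})^*\Phi(e^{it})=I_{\mathcal{E}}$ a.e. on the unit circle. $M_{z^k}^{\mathcal{E}_k}$ is multiplication by $z^k$ on $H^2_{\mathcal{E}_k}(\mathbb{D})$. The truncated shift of index $k$ on $\mathcal{E}_k\otimes\mathbb{C}^k$ (the direct sum of $k$ copies of $\mathcal{E}_k$) is $J_1=0$ and, for $k\ge2$, $J_k(x_1,\ldots,x_k)=(0,x_1,\ldots,x_{k-1})$. Under the identification $(a_0,\ldots,a_{k-1})\leftrightarrow\sum_{m=0}^{k-1}a_mz^m$ it becomes $J_k\big(\sum_{m=0}^{k-1}a_mz^m\big)=\sum_{m=0}^{k-2}a_mz^{m+1}$ for $k\ge2$. Invariant means $J_k\mathcal{M}\subseteq\mathcal{M}$. *)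

(* Defs.v *)
From HB Require Import structures.
From mathcomp Require Import all_boot all_order all_algebra.
From mathcomp Require Import complex.
From mathcomp Require Import all_classical all_reals all_analysis ring lra.

Set Implicit Arguments.
Unset Strict Implicit.
Unset Printing Implicit Defensive.

Import Order.TTheory GRing.Theory Num.Theory Num.Def.
Import numFieldNormedType.Exports.
Local Open Scope classical_set_scope.
Local Open Scope ring_scope.
Local Open Scope complex_scope.

Section DotNorm.
Context (C : numClosedFieldType) (U : lmodType C) (f : {dot U for conjC}).
Implicit Types (u v : U) (a : C).

Lemma dot_CauchySchwarz u v : `|f u v| ^+ 2 <= f u u * f v v.
Proof.
have [->|v0] := eqVneq v 0; first by rewrite !(linear0r f) normr0 expr0n mulr0.
pose a := f u v / f v v; pose w := u - a *: v.
have fv0 : f v v != 0 by rewrite dnorm_eq0.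
have wv : f w v = 0 by rewrite linearBl/= linearZl_LR/= divfK// subrr.
have -> : u = w + a *: v by rewrite subrK.
rewrite linearDl/= wv add0r linearZl_LR/= normrM exprMn.
rewrite (ger0_norm (dnorm_ge0 f v)) [f v v ^+ 2]expr2 mulrA -dnormZ.
have wav : f w (a *: v) = 0 by rewrite linearZr_LR/= wv mulr0.
by rewrite ler_wpM2r ?dnorm_ge0// (hnormDd wav) lerDr dnorm_ge0.
Qed.

Lemma dot_norm_triangle u v :
  sqrtC (f (u + v) (u + v)) <= sqrtC (f u u) + sqrtC (f v v).
Proof.
rewrite -ler_sqr ?nnegrE ?addr_ge0 ?sqrtC_ge0 ?dnorm_ge0//.
rewrite sqrrD !sqrtCK dnormD [leRHS]addrAC lerD2l.
have -> : f u v + (f u v)^* = 'Re (f u v) *+ 2.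
  by rewrite ReE -[RHS]mulr_natr divfK// pnatr_eq0.
rewrite lerMn2r/=; apply: (le_trans (leif_Re_Creal (f u v)).1).
rewrite -ler_sqr ?nnegrE ?mulr_ge0 ?sqrtC_ge0 ?dnorm_ge0//.
by rewrite exprMn !sqrtCK dot_CauchySchwarz.
Qed.

Lemma dot_normZ a u : sqrtC (f (a *: u) (a *: u)) = `|a| * sqrtC (f u u).
Proof.
by rewrite dnormZ sqrtCM ?nnegrE ?exprn_ge0 ?dnorm_ge0// sqrCK.
Qed.

Lemma dot_norm_eq0 u : sqrtC (f u u) = 0 -> u = 0.
Proof. by move/eqP; rewrite sqrtC_eq0 dnorm_eq0 => /eqP. Qed.

End DotNorm.

(* Complex Hilbert spaces: the norm is the one induced by the inner product,
   which is linear in its first argument. *)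
HB.mixin Record NormedModule_isInnerProduct (R : realType) V
    of NormedModule R[i] V := {
  hdot : {dot V for (@conjC R[i])} ;
  hdot_norm : forall x : V, `|x| ^+ 2 = hdot x x }.

#[short(type="hilbertType")]
HB.structure Definition Hilbert (R : realType) :=
  {V of CompleteNormedModule R[i] V & NormedModule_isInnerProduct R V}.

Local Notation "'[ x , y ]" := (hdot x y) : ring_scope.

Section RealNorm.
Context (R : realType) (E : hilbertType R).
Implicit Types (x y : E).

(* Norms of an R[i]-module have values in R[i]; hnorm is the same norm in R. *)
Definition hnorm x : R := complex.Re `|x|.

Lemma hnormE x : `|x| = (hnorm x)%:C.
Proof. by rewrite /hnorm RRe_real// normr_real. Qed.

Lemma hnorm_ge0 x : 0 <= hnorm x.
Proof. by rewrite -ler0c -hnormE. Qed.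

Lemma hnormD x y : hnorm (x + y) <= hnorm x + hnorm y.
Proof. by rewrite -lecR rmorphD/= -!hnormE ler_normD. Qed.

Lemma hnorm_sqrD x y :
  hnorm (x + y) ^+ 2 <= 2 * hnorm x ^+ 2 + 2 * hnorm y ^+ 2.
Proof.
apply: (@le_trans _ _ ((hnorm x + hnorm y) ^+ 2)).
  by rewrite ler_sqr ?nnegrE ?addr_ge0 ?hnorm_ge0// hnormD.
have := sqr_ge0 (hnorm x - hnorm y); nra.
Qed.

Lemma hnormZ (a : R[i]) x : hnorm (a *: x) = complex.Re `|a| * hnorm x.
Proof. by apply: complexI; rewrite rmorphM/= -!hnormE normrZ.
Qed.

Lemma hnorm0 : hnorm (0 : E) = 0.
Proof. by rewrite -(scale0r (0 : E)) hnormZ normr0 mul0r. Qed.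

Lemma hnorm_sqrE x : (hnorm x ^+ 2)%:C = '[x, x].
Proof. by rewrite rmorphXn/= -hnormE hdot_norm. Qed.

End RealNorm.

Lemma normc_real (R : realType) (x : R) : `|x%:C| = `|x|%:C :> R[i].
Proof. by rewrite normc_def/= expr0n/= addr0 sqrtr_sqr. Qed.

Lemma cvg_real_complex (R : realType) (u : nat -> R) (l : R) :
  u @ \oo --> l -> (fun n => (u n)%:C : R[i]^o) @ \oo --> (l%:C : R[i]^o).
Proof.
move=> /cvgrPdist_lt ul; apply/(@cvgrPdist_lt R[i] R[i]^o) => e e0.
have eE : (complex.Re e)%:C = e by rewrite RRe_real// gtr0_real.
have e0' : 0 < complex.Re e by rewrite -ltcR eE.
near=> n; rewrite -eE -rmorphB/= normc_real/= ltcR.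
by near: n; exact: ul.
Unshelve. all: by end_near. Qed.

(* The Hardy space H^2_E(D): an element is given by its Taylor coefficients
   at 0, which are square-summable; hardy_eval below is the corresponding
   analytic function on the disc. *)
Section H2.
Context (R : realType) (E : hilbertType R).

Definition sqsummable (a : nat -> E) :=
  cvgn (series (fun n => hnorm (a n) ^+ 2)).

Definition h2coefs : {pred nat -> E} := fun a => `[< sqsummable a >].

Lemma h2coefs_submod_closed : submod_closed h2coefs.
Proof.
split=> [|c a b].
  apply/asboolP; rewrite /sqsummable.
  rewrite (_ : (fun n => _) = fun=> 0).
    by rewrite /series/=; under eq_fun do rewrite big1//; exact: is_cvg_cst.
  by apply/funext => n; rewrite -[X in hnorm X]/(0 : E) hnorm0 expr0n.
move=> /asboolP ha /asboolP hb; apply/asboolP; rewrite /sqsummable.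
pose k : R := complex.Re `|c|.
apply: (@series_le_cvg _ _ ((2 * k ^+ 2 : R) *: (fun n => hnorm (a n) ^+ 2)
  + (2 : R) *: (fun n => hnorm (b n) ^+ 2))).
- by move=> n; exact: sqr_ge0.
- move=> n; apply: addr_ge0; apply: mulr_ge0; rewrite ?sqr_ge0//.
  by rewrite mulr_ge0 ?sqr_ge0.
- move=> n; apply: le_trans (hnorm_sqrD _ _) _.
  by rewrite hnormZ exprMn mulrA; exact: lexx.
- by apply: is_cvg_seriesD; exact: is_cvg_seriesZ.
Qed.

HB.instance Definition _ := GRing.isSubmodClosed.Build _ _ h2coefs
  h2coefs_submod_closed.

Record hardy := Hardy { coef :> nat -> E ; _ : coef \in h2coefs }.

HB.instance Definition _ := [isSub for coef].
HB.instance Definition _ := [Choice of hardy by <:].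
HB.instance Definition _ := [SubChoice_isSubLmodule of hardy by <:].

Implicit Types f g h : hardy.

Lemma hardyP f : sqsummable f.
Proof. by case: f => a /= /asboolP. Qed.

Lemma hardy_sqr_lin f g (c : R[i]) :
  cvgn (series (fun n => '[f n + c *: g n, f n + c *: g n]) : nat -> R[i]^o).
Proof.
have /cvg_ex[l /cvg_real_complex hl] := @hardyP (f + c *: g).
apply/cvg_ex; exists (l%:C); apply: cvg_trans hl; apply: near_eq_cvg.
apply: nearW => n /=; rewrite /series/= rmorph_sum.
by apply: eq_bigr => i _; rewrite -hnorm_sqrE.
Qed.

Lemma hdot_polar (x y : E) : '[x, y] = 4^-1%R *
  (('[x + 1 *: y, x + 1 *: y] - '[x + (-1) *: y, x + (-1) *: y])
   + 'i%R * ('[x + 'i%R *: y, x + 'i%R *: y] - '[x + (- 'i%R) *: y, x + (- 'i%R) *: y])).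
Proof.
have H (c : R[i]) : '[x + c *: y, x + c *: y] =
    '[x, x] + c^* * '[x, y] + c * '[y, x] + c * c^* * '[y, y].
  rewrite linearDl/= linearDr/= linearZr_LR/= (linearDr hdot)/= linearZl_LR/=.
  by rewrite linearZl_LR/= linearZr_LR/= !mulrA !addrA.
rewrite !H !rmorphN rmorph1 /= conjCi.
have := @sqrCi R[i]; set i := 'i%R; rewrite expr2 => ii.
by field: ii.
Qed.

Definition hardy_dot f g : R[i] :=
  limn (series (fun n => '[f n, g n]) : nat -> R[i]^o).

Lemma hardy_dot_cvg f g :
  cvgn (series (fun n => '[f n, g n]) : nat -> R[i]^o).
Proof.
pose u (c : R[i]) : nat -> R[i]^o := fun n => '[f n + c *: g n, f n + c *: g n].
have uc c : cvgn (series (u c)) by exact: hardy_sqr_lin.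
have -> : (fun n => '[f n, g n]) =
    (4^-1 : R[i]^o) *: ((u 1 - u (-1)) + ('i%R : R[i]^o) *: (u 'i%R - u (- 'i%R))).
  by apply/funext => n; rewrite hdot_polar.
apply: (@is_cvg_seriesZ R[i]); apply: (@is_cvg_seriesD R[i]); first exact: (@is_cvg_seriesB R[i]).
by apply: (@is_cvg_seriesZ R[i]); exact: (@is_cvg_seriesB R[i]).
Qed.

Lemma hardy_dot_bilinear : bilinear_for
  (GRing.Scale.Law.clone _ _ *%R _)
  (GRing.Scale.Law.clone _ _ (@conjC R[i] \; *%R) _) hardy_dot.
Proof.
split=> [g a f1 f2|f a g1 g2]; rewrite /hardy_dot/=.
  have -> : (fun n => '[(a *: f1 + f2) n, g n]) =
      (a : R[i]^o) *: ((fun n => '[f1 n, g n]) : nat -> R[i]^o)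
      + ((fun n => '[f2 n, g n]) : nat -> R[i]^o).
    by apply/funext => n; rewrite linearDl/= linearZl_LR.
  rewrite lim_seriesD; first by rewrite lim_seriesZ//; exact: hardy_dot_cvg.
    by apply: (@is_cvg_seriesZ R[i]); exact: hardy_dot_cvg.
  exact: hardy_dot_cvg.
have -> : (fun n => '[f n, (a *: g1 + g2) n]) =
    (a^* : R[i]^o) *: ((fun n => '[f n, g1 n]) : nat -> R[i]^o)
    + ((fun n => '[f n, g2 n]) : nat -> R[i]^o).
  by apply/funext => n; rewrite linearDr/= linearZr_LR.
rewrite lim_seriesD; first by rewrite lim_seriesZ//; exact: hardy_dot_cvg.
  by apply: (@is_cvg_seriesZ R[i]); exact: hardy_dot_cvg.
exact: hardy_dot_cvg.
Qed.

HB.instance Definition _ := bilinear_isBilinear.Build R[i] hardy hardy R[i]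
  _ _ hardy_dot hardy_dot_bilinear.

Lemma cvg_conjc (u : nat -> R[i]^o) (l : R[i]^o) :
  u @ \oo --> l -> (fun n => (u n)^* : R[i]^o) @ \oo --> (l^* : R[i]^o).
Proof.
move=> /cvgrPdist_lt ul; apply/cvgrPdist_lt => e e0.
near=> n; rewrite -rmorphB/= norm_conjC; near: n; exact: ul.
Unshelve. all: by end_near. Qed.

Lemma hardy_dot_herm f g :
  hardy_dot f g = (-1) ^+ false * (hardy_dot g f)^*.
Proof.
rewrite expr0 mul1r /hardy_dot; apply: (@cvg_lim R[i]^o); first exact: norm_hausdorff.
have -> : series (fun n => '[f n, g n]) =
    (fun n => (series (fun n => '[g n, f n]) n)^* : R[i]^o).
  apply/funext => n; rewrite /series/= rmorph_sum; apply: eq_bigr => k _.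
  by rewrite hermC/= expr0 mul1r.
exact/cvg_conjc/hardy_dot_cvg.
Qed.

HB.instance Definition _ := isHermitianSesquilinear.Build R[i] hardy false
  (@conjC R[i]) hardy_dot hardy_dot_herm.

Lemma hardy_dotE f :
  hardy_dot f f = (limn (series (fun n => hnorm (f n) ^+ 2)))%:C.
Proof.
apply: (@cvg_lim R[i]^o); first exact: norm_hausdorff.
have -> : series (fun n => '[f n, f n]) =
    (fun n => (series (fun n => hnorm (f n) ^+ 2) n)%:C : R[i]^o).
  apply/funext => n; rewrite /series/= rmorph_sum; apply: eq_bigr => k _.
  by rewrite -hnorm_sqrE.
exact/cvg_real_complex/hardyP.
Qed.

Lemma hardy_sum_le f n :
  \sum_(0 <= k < n) hnorm (f k) ^+ 2 <= limn (series (fun n => hnorm (f n) ^+ 2)).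
Proof.
apply: (nondecreasing_cvgn_le _ (@hardyP f)).
by apply/nondecreasing_seqP => m; rewrite /series/= big_nat_recr//= lerDl sqr_ge0.
Qed.

Lemma hardy_dot_gt0 f : f != 0 -> 0 < hardy_dot f f.
Proof.
move=> f0; rewrite hardy_dotE ltcR.
have [n fn0] : exists n, f n != 0.
  apply: contrapT => /forallNP fz; move/eqP: f0; apply; apply/val_inj/funext => n.
  by have /negP := fz n; rewrite negbK => /eqP.
apply: lt_le_trans (hardy_sum_le f n.+1).
rewrite big_nat_recr//= ltr_wpDl ?sumr_ge0 ?exprn_gt0//.
  by move=> *; rewrite sqr_ge0.
by rewrite lt_def hnorm_ge0 andbT; apply: contra fn0 => /eqP h;
  rewrite -normr_eq0 hnormE h.
Qed.

HB.instance Definition _ := isDotProduct.Build R[i] hardy hardy_dot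
  hardy_dot_gt0.

Definition hardy_norm f : R[i] := sqrtC (hardy_dot f f).

HB.instance Definition _ := @Lmodule_isNormed.Build R[i] hardy hardy_norm
  (dot_norm_triangle hardy_dot) (dot_normZ hardy_dot)
  (@dot_norm_eq0 _ _ hardy_dot).

Lemma hardy_normE f :
  `|f| ^+ 2 = (limn (series (fun n => hnorm (f n) ^+ 2)))%:C.
Proof. by rewrite -hardy_dotE sqrtCK. Qed.

Lemma hardy_norm_le f (e : R) : 0 <= e -> (`|f| <= e%:C) =
  (limn (series (fun n => hnorm (f n) ^+ 2)) <= e ^+ 2).
Proof.
move=> e0; rewrite -[LHS]ler_sqr ?nnegrE ?normr_ge0 ?ler0c//.
by rewrite hardy_normE -rmorphXn/= lecR.
Qed.

Lemma hardy_coef_le f n : `|f n| <= `|f|.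
Proof.
rewrite -ler_sqr ?nnegrE ?normr_ge0// hardy_normE hnormE -rmorphXn/= lecR.
apply: le_trans (hardy_sum_le f n.+1).
by rewrite big_nat_recr//= lerDr sumr_ge0// => *; rewrite sqr_ge0.
Qed.

Lemma hnorm_cvg (T : Type) (F : set_system T) (FF : Filter F) (u : T -> E) l :
  u @ F --> l -> (fun t => hnorm (u t)) @ F --> hnorm l.
Proof.
move=> /cvgrPdist_lt ul; apply/cvgrPdist_lt => e e0.
have e0' : 0 < (e%:C : R[i]) by rewrite ltcR.
near=> t; rewrite -ltcR -normc_real rmorphB/= -!hnormE.
by apply: le_lt_trans (ler_dist_dist _ _) _; near: t; exact: ul.
Unshelve. all: by end_near. Qed.

Lemma hardy_complete (F : set_system hardy) :
  ProperFilter F -> cauchy F -> cvg F.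
Proof.
move=> FF /cauchy_ballP Fc.
have Fn n : cvg ((fun f : hardy => f n) @ F).
  apply: cauchy_cvg; apply/cauchy_ballP => e e0.
  have := Fc _ e0; rewrite !near_simpl => -[[A B]]/= [FA FB] AB.
  exists ((fun f : hardy => f n) @` A, (fun f : hardy => f n) @` B).
    by split; [apply: filterS FA|apply: filterS FB] => f Af; exists f.
  move=> [x y]/= [[f Af <-] [g Bg <-]].
  have := AB (f, g) (conj Af Bg).
  rewrite -ball_normE -[in X in _ -> X]ball_normE /ball_/=.
  exact/le_lt_trans/(hardy_coef_le (f - g) n).
pose l : nat -> E := fun n => lim ((fun f : hardy => f n) @ F).
have near_l (e : R) : 0 < e -> F [set f : hardy | forall N,
    \sum_(0 <= k < N) hnorm (f k - l k) ^+ 2 <= e ^+ 2].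
  move=> e0; have eC : 0 < (e%:C : R[i]) by rewrite ltcR.
  have H : \forall f \near F, \forall g \near F, ball f (e%:C : R[i]) g.
    exact: nearP_dep (Fc _ eC).
  apply: filterS H => f nf N.
  have : (fun g : hardy => \sum_(0 <= k < N) hnorm (f k - g k) ^+ 2) @ F -->
      \sum_(0 <= k < N) hnorm (f k - l k) ^+ 2.
    apply: (@cvg_big R nat _ 0 xpredT (@add_continuous R) hardy F) => //.
    move=> k _; rewrite expr2; under eq_fun do rewrite expr2.
    by apply: cvgM; apply: hnorm_cvg; apply: cvgB; [exact: cvg_cst|exact: Fn|exact: cvg_cst|exact: Fn].
  move=> /cvgr_to_le; apply; apply: filterS nf => g.
  rewrite -ball_normE /ball_/= => /ltW; rewrite (hardy_norm_le _ (ltW e0)).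
  by move=> /(le_trans _); apply; exact: (hardy_sum_le (f - g) N).
have bnd (a : nat -> E) (e : R) :
    (forall N, \sum_(0 <= k < N) hnorm (a k) ^+ 2 <= e) ->
    sqsummable a /\ limn (series (fun n => hnorm (a n) ^+ 2)) <= e.
  move=> ae.
  have ca : sqsummable a.
    apply: nondecreasing_is_cvgn; last by exists e => _ [n _ <-]; exact: ae.
    apply/nondecreasing_seqP => m.
    by rewrite /series/= big_nat_recr//= lerDl sqr_ge0.
  by split=> //; apply: limr_le => //; exact: nearW.
have [f Hf] := @filter_ex _ _ FF _ (near_l _ ltr01).
have fl : (fun n => f n - l n) \in h2coefs.
  by apply/asboolP; exact: (bnd _ _ Hf).1.
have hl : l \in h2coefs.
  have -> : l = (coef f : nat -> E) - (fun n => f n - l n).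
    by apply/funext => n; rewrite -[RHS]/(f n - (f n - l n)) subKr.
  by rewrite rpredB//; case: f {Hf fl}.
apply/cvg_ex; exists (Hardy hl); apply/cvgrPdist_le => e e0.
have eE : (complex.Re e)%:C = e by rewrite RRe_real// gtr0_real.
have e0' : 0 < complex.Re e by rewrite -ltcR eE.
apply: filterS (near_l _ e0') => g Hg.
rewrite distrC -eE (hardy_norm_le _ (ltW e0')).
exact: (bnd _ _ Hg).2.
Qed.

HB.instance Definition _ := Uniform_isComplete.Build hardy hardy_complete.

Lemma hardy_norm_sqr f : `|f| ^+ 2 = hardy_dot f f.
Proof. exact: sqrtCK. Qed.

HB.instance Definition _ :=
  NormedModule_isInnerProduct.Build R hardy hardy_norm_sqr.

End H2.

Section Operators.
Context (R : realType) (E F : hilbertType R).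

Definition bounded_op (T : E -> F) :=
  exists C : R, forall x, hnorm (T x) <= C * hnorm x.

(* For bounded linear T the vector w exists (Riesz) and is unique, so the
   default value of xget is not used. *)
Definition adjoint (T : E -> F) : F -> E :=
  fun y => xget 0 [set w | forall x, '[T x, y] = '[x, w]].

Definition nullspace (T : E -> F) : set E := [set x | T x = 0].

Definition unitarily_isomorphic :=
  exists U : {linear E -> F}, bijective U /\
    forall x y, '[U x, U y] = '[x, y].

End Operators.
Arguments unitarily_isomorphic {R} E F.

Definition separable (R : realType) (E : hilbertType R) :=
  exists S : set E, countable S /\ dense S.

Definition hardy_eval (R : realType) (E : hilbertType R) (f : hardy E)
  (z : R[i]) : E := limn (series (fun n => z ^+ n *: f n)).

Section AnalyticFunctions.
Context (R : realType) (E F : hilbertType R).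
Implicit Types Phi : R[i] -> {linear E -> F}.

(* Phi(z) = \sum_n z^n A_n in operator norm on the open unit disc, with
   bounded coefficients A_n. *)
Definition analytic_on_disc Phi :=
  exists2 A : nat -> {linear E -> F}, (forall n, bounded_op (A n)) &
    forall z, `|z| < 1 -> forall e : R, 0 < e ->
      \forall n \near \oo, forall x,
        hnorm (Phi z x - \sum_(0 <= j < n) z ^+ j *: A j x) <= e * hnorm x.

(* Values outside the open unit disc are irrelevant. *)
Definition Hinfty Phi :=
  (exists C : R, forall z, `|z| < 1 -> forall x,
     hnorm (Phi z x) <= C * hnorm x) /\
  analytic_on_disc Phi.

(* U is the strong radial limit Phi(e^{it}). *)
Definition boundary_value Phi (t : R) (U : E -> F) :=
  forall x, Phi (r%:C * (cos t +i* sin t)) x @[r --> 1^'-] --> U x.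

Definition inner_function Phi :=
  {ae (@lebesgue_measure R), forall t : R, t \in `[0, 2 * pi] ->
    exists U : {linear E -> F}, [/\ bounded_op U, boundary_value Phi t U &
      forall x, adjoint U (U x) = x]}.

(* h |-> m h pointwise on the disc. When m h has square-summable Taylor
   coefficients (e.g. for m in Hinfty), g is unique and the default value of
   xget is not used. *)
Definition mul_op (m : R[i] -> E -> F) : hardy E -> hardy F :=
  fun h => xget 0 [set g : hardy F |
    forall z, `|z| < 1 -> hardy_eval g z = m z (hardy_eval h z)].

Definition toeplitz Phi : hardy E -> hardy F := mul_op (fun z => Phi z).

End AnalyticFunctions.

Definition mulz (R : realType) (E : hilbertType R) (k : nat) :
  hardy E -> hardy E := mul_op (fun z x => z ^+ k *: x).

Section TruncatedShift.
Context (R : realType) (E : hilbertType R) (k : nat).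

(* (x_1, ..., x_k) |-> (0, x_1, ..., x_{k-1}) on k copies of E. *)
Definition truncated_shift (x : 'I_k -> E) : 'I_k -> E :=
  fun i => if val i == 0%N then 0 else x (ord_pred i).

(* The product topology is the norm topology of the direct sum E (x) C^k. *)
Definition closed_subspace (M : set ('I_k -> E)) :=
  [/\ M 0, forall (a : R[i]) x y, M x -> M y -> M (a *: x + y) &
      closed (M : set {ptws 'I_k -> E})].

Let poly_coefs (x : 'I_k -> E) : nat -> E := fun n => oapp x 0 (insub n).

Lemma poly_coefs_h2 x : poly_coefs x \in @h2coefs R E.
Proof.
apply/asboolP/cvg_ex.
exists (series (fun n => hnorm (poly_coefs x n) ^+ 2) k).
apply: cvg_near_cst; near=> n.
have kn : (k <= n)%N by near: n; exact: nbhs_infty_ge.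
rewrite /series/= [LHS](big_cat_nat (leq0n k) kn)/= [X in _ + X]big_nat_cond.
rewrite [X in _ + X]big1 ?addr0//.
move=> m /andP[/andP[km _] _].
by rewrite /poly_coefs insubN -?leqNgt// hnorm0 expr0n.
Unshelve. all: by end_near. Qed.

(* (a_0, ..., a_{k-1}) |-> \sum_m a_m z^m *)
Definition hardy_poly (x : 'I_k -> E) : hardy E := Hardy (poly_coefs_h2 x).

End TruncatedShift.

(* Main.v *)
From HB Require Import structures.
Require Import Defs.
From mathcomp Require Import all_boot all_order all_algebra.
From mathcomp Require cyclic separable cyclotomic.
From mathcomp Require Import complex.
From mathcomp Require Import all_classical all_reals all_analysis ring lra zify.
Set Implicit Arguments.
Unset Strict Implicit.
Unset Printing Implicit Defensive.
Import Order.TTheory GRing.Theory Num.Theory Num.Def.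
Import numFieldNormedType.Exports.
Local Open Scope classical_set_scope.
Local Open Scope ring_scope.
Local Open Scope complex_scope.

(** Elements of [hardy E] are sequences of Taylor coefficients, so that
    multiplication by z is the coefficient shift [hshift], whose adjoint is
    the backward shift [hback].

    Analytic Toeplitz operators. A symbol bounded by C on the disc acts on
    [hardy E] with norm at most C ([toeplitz_spec]). On a circle of radius
    r < 1 the symbol is uniformly close to a partial sum of its power series,
    hence nearly bounded by C there; averaging over the N-th roots of unity
    ([discrete_parseval]) turns this into an l2 bound for the Cauchy product of
    the coefficients ([conv_coef_le]), and then r tends to 1. Pointwise
    products of symbols therefore become compositions of operators.

    That the constant C is sharp replaces all use of boundary integrals: if
    Theta and Phi are contractive on the disc and both products of them are
    z^k, then multiplication by z^k, an isometry, is in both orders a product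
    of the contractions T_Theta and T_Phi, so these are isometries too; the same
    argument at a point of the unit circle shows that Theta and Phi are inner.

    From invariance to a factorization. Let S be the set of all f in [hardy E]
    whose first k coefficients form an element of M. It is a closed
    shift-invariant subspace containing z^k H^2, and it has the form T_Theta H^2
    ([shift_invariant_factorization]). This is proved by induction on k. Let P
    be the projection onto L = {l : z^(k-1) l in S}; every f in S has f(0) in L,
    so S is contained in the range of the Potapov factor P + z (1 - P), and
    its preimage under this factor contains z^(k-1) H^2. After k steps
    Theta is a product of k such factors and Phi is the product, in the
    opposite order, of the factors (1 - P) + z P; both act on E itself. Since
    T_Theta is isometric and T_Theta T_Phi = z^k, a vector g is orthogonal to the
    range of T_Phi iff T_Theta g is orthogonal to z^k H^2, that is, iff T_Theta g
    is a polynomial of degree less than k; such polynomials in S are M.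

    From a factorization to invariance ([model_space_invariant]). As z^k has
    the backward shift as a left inverse, T_Theta T_Phi = z^k forces the range of
    T_Phi to be closed. If x in M corresponds to T_Theta g, decompose
    z g = T_Phi h + u with u orthogonal to that range. Then
    T_Theta u = z T_Theta g - z^k h lies in M and has the same first k
    coefficients as z T_Theta g, so it is the truncated shift of x. *)

(** * Moduli and norms with real values *)

Local Notation "'[ x , y ]" := (hdot x y) : ring_scope.

(** The norm of R[i] is itself an element of R[i]; [cmod] is its value in R. It
    stays folded under simplification, which would expose a square root. *)
Definition cmod (R : realType) (z : R[i]) : R := complex.Re `|z|.
Arguments cmod : simpl never.

Section Modulus.
Context (R : realType).
Implicit Types (z w : R[i]) (r : R).

Lemma cmodE z : `|z| = (cmod z)%:C.
Proof. by rewrite /cmod RRe_real// normr_real. Qed.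

Lemma cmod_ge0 z : 0 <= cmod z.
Proof. by rewrite -ler0c -cmodE. Qed.

Lemma cmodM z w : cmod (z * w) = cmod z * cmod w.
Proof. by apply: complexI; rewrite rmorphM/= -!cmodE normrM. Qed.

Lemma cmodX z n : cmod (z ^+ n) = cmod z ^+ n.
Proof. by apply: complexI; rewrite rmorphXn/= -!cmodE normrX. Qed.

Lemma cmod_real r : cmod (r%:C : R[i]) = `|r|.
Proof. by rewrite /cmod normc_real. Qed.

Lemma cmod_lt z r : (`|z| < r%:C) = (cmod z < r).
Proof. by rewrite cmodE ltcR. Qed.

Lemma cmod_eq0 z : cmod z = 0 -> z = 0.
Proof. by move=> z0; apply/eqP; rewrite -normr_eq0 cmodE z0. Qed.

Lemma cmod_lt1 z : (`|z| < 1) = (cmod z < 1).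
Proof. by rewrite -cmod_lt. Qed.

End Modulus.

Section HilbertBasics.
Context (R : realType) (E : hilbertType R).
Implicit Types (x y : E).

Lemma hnorm_opp x : hnorm (- x) = hnorm x.
Proof. by apply: complexI; rewrite -!hnormE normrN. Qed.

Lemma hnorm_eq0 x : hnorm x = 0 -> x = 0.
Proof. by move=> x0; apply/eqP; rewrite -normr_eq0 hnormE x0. Qed.

Lemma hnorm_distC x y : hnorm (x - y) = hnorm (y - x).
Proof. by rewrite -hnorm_opp opprB. Qed.

Lemma hnorm_scale (a : R[i]) x : hnorm (a *: x) = cmod a * hnorm x.
Proof. exact: hnormZ. Qed.

Lemma hnorm_sum (I : Type) (s : seq I) (P : pred I) (f : I -> E) :
  hnorm (\sum_(i <- s | P i) f i) <= \sum_(i <- s | P i) hnorm (f i).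
Proof.
elim/big_rec2: _ => [|i b a _ ab]; first by rewrite hnorm0.
by apply: le_trans (Defs.hnormD _ _) _; rewrite lerD2l.
Qed.

Lemma hdotC x y : '[x, y] = conjC '[y, x].
Proof. by rewrite hermC/= expr0 mul1r. Qed.

Lemma hdot_le x y : cmod '[x, y] <= hnorm x * hnorm y.
Proof.
rewrite -ler_sqr ?nnegrE ?mulr_ge0 ?hnorm_ge0 ?cmod_ge0//.
rewrite -lecR rmorphXn/= -cmodE exprMn rmorphM/= !hnorm_sqrE.
exact: dot_CauchySchwarz.
Qed.

Lemma parallelogram x y :
  hnorm (x + y) ^+ 2 + hnorm (x - y) ^+ 2 = 2 * (hnorm x ^+ 2 + hnorm y ^+ 2).
Proof.
apply: complexI; rewrite rmorphM rmorph_nat !rmorphD/= !hnorm_sqrE.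
rewrite !linearDl/= !linearNl/= !linearDr/= !linearNr/=.
ring.
Qed.

Lemma hnorm_sqrD_orthogonal x y : '[y, x] = 0 ->
  hnorm (x + y) ^+ 2 = hnorm x ^+ 2 + hnorm y ^+ 2.
Proof.
move=> yx; apply: complexI; rewrite rmorphD/= !hnorm_sqrE linearDl/= !linearDr/=.
by rewrite (hdotC x y) yx rmorph0 addr0 add0r.
Qed.

(** Neighbourhoods in E are indexed by positive elements of R[i]; convergence,
    the Cauchy property and closedness are restated with real radii, in which
    the estimates are carried out. *)
Lemma hcvgP (T : Type) (F : set_system T) (FF : Filter F) (u : T -> E) l :
  (u @ F --> l) <->
  forall e : R, 0 < e -> \forall t \near F, hnorm (l - u t) < e.
Proof.
split=> [/cvgrPdist_lt ul e e0|ul].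
  have e0' : 0 < (e%:C : R[i]) by rewrite ltcR.
  by near=> t; rewrite -ltcR -hnormE; near: t; exact: ul.
apply/cvgrPdist_lt => e e0.
have eE : (complex.Re e)%:C = e by rewrite RRe_real// gtr0_real.
have e0' : 0 < complex.Re e by rewrite -ltcR eE.
by near=> t; rewrite -eE hnormE ltcR; near: t; exact: ul.
Unshelve. all: by end_near. Qed.

Lemma hcauchy (u : nat -> E) :
  (forall e : R, 0 < e -> exists N, forall n m, (N <= n)%N -> (N <= m)%N ->
     hnorm (u n - u m) < e) -> cvgn u.
Proof.
move=> uc; apply/cauchy_cvgP/cauchy_ballP => e e0.
have eE : (complex.Re e)%:C = e by rewrite RRe_real// gtr0_real.
have e0' : 0 < complex.Re e by rewrite -ltcR eE.
have [N uN] := uc _ e0'.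
exists ([set x | exists2 n, (N <= n)%N & u n = x],
  [set x | exists2 n, (N <= n)%N & u n = x]) => /=.
  by split; exists N => // n /= Nn; exists n.
move=> [x y]/= [[n Nn <-] [m Nm <-]].
by rewrite -ball_normE /ball_/= -eE hnormE ltcR; exact: uN.
Qed.

End HilbertBasics.

Section Closed.
Context (R : realType).
Implicit Types E F : hilbertType R.

Lemma hclosedP E (A : set E) : closed A <->
  forall x, (forall e : R, 0 < e -> exists2 y, A y & hnorm (x - y) < e) -> A x.
Proof.
split=> [Acl x Ax|Ax x /= clx].
  apply: Acl => B /nbhs_ballP[e /= e0 eB].
  have eE : (complex.Re e)%:C = e by rewrite RRe_real// gtr0_real.
  have [|y Ay xy] := Ax (complex.Re e); first by rewrite -ltcR eE.
  exists y; split=> //; apply: eB.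
  by rewrite -ball_normE /ball_/= -eE hnormE ltcR.
apply: Ax => e e0.
have [|y [Ay]] := clx (ball x (e%:C : R[i])).
  by apply: nbhsx_ballx; rewrite ltcR.
by rewrite -ball_normE /ball_/= hnormE ltcR => xy; exists y.
Qed.

(** The constant C may be negative, in which case E is trivial; hence the
    radius is divided by |C| + 1. *)
Lemma lipschitz_closed_preimage E F (T : E -> F) (C : R) (A : set F) :
  (forall x y, hnorm (T x - T y) <= C * hnorm (x - y)) ->
  closed A -> closed (T @^-1` A).
Proof.
move=> TC /hclosedP Acl; apply/hclosedP => x xA; apply: Acl => e e0.
have C0 : 0 < `|C| + 1 by rewrite ltr_wpDl.
have [|y Ay xy] := xA (e / (`|C| + 1)); first by rewrite divr_gt0.
exists (T y) => //; apply: le_lt_trans (TC _ _) _.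
rewrite ltr_pdivlMr// in xy; apply: le_lt_trans xy.
have := hnorm_ge0 (x - y); have := ler_norm C; nra.
Qed.

End Closed.

(** * Orthogonal projection, Riesz representation, adjoints *)

Section Projection.
Context (R : realType) (E : hilbertType R) (L : set E).
Context (L0 : L 0) (Llin : forall a x y, L x -> L y -> L (a *: x + y)).
Context (Lcl : closed L).

(** A minimizing sequence is Cauchy by the parallelogram law, because the
    midpoint of two of its terms is again in L and so no closer to x than the
    infimum. *)
Lemma closest_point x :
  exists2 p, L p & forall l, L l -> hnorm (x - p) ^+ 2 <= hnorm (x - l) ^+ 2.
Proof.
pose D := [set hnorm (x - l) ^+ 2 | l in L]; pose d := inf D.
have Dlb : has_lbound D by exists 0 => _ [l _ <-]; exact: sqr_ge0.
have Dinf : has_inf D by split=> //; exists (hnorm (x - 0) ^+ 2); exists 0.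
have dl l : L l -> d <= hnorm (x - l) ^+ 2.
  by move=> Ll; apply: ge_inf => //; exists l.
have [u Lu] : {u : nat -> E & forall n, L (u n) /\
    hnorm (x - u n) ^+ 2 < d + n.+1%:R^-1}.
  apply: (@choice _ _ (fun (n : nat) l =>
    L l /\ hnorm (x - l) ^+ 2 < d + n.+1%:R^-1)) => n.
  have [|_ [l Ll <-] ld] := @inf_adherent _ D (n.+1%:R^-1) _ Dinf.
    by rewrite invr_gt0.
  by exists l.
have uu n m : hnorm (u n - u m) ^+ 2 <= 2 * n.+1%:R^-1 + 2 * m.+1%:R^-1.
  have [Ln nd] := Lu n; have [Lm md] := Lu m.
  have := parallelogram (x - u m) (x - u n).
  have -> : x - u m - (x - u n) = u n - u m by rewrite opprB addrC subrKA.
  pose c : E := (2^-1 : R)%:C *: u n + (2^-1 : R)%:C *: u m.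
  have Lc : L c by apply: Llin => //; rewrite -[_ *: _]addr0; exact: Llin.
  have -> : x - u m + (x - u n) = (2 : R)%:C *: (x - c).
    rewrite /c -scalerDr scalerBr scalerA -rmorphM/= divff// rmorph1 scale1r.
    by rewrite rmorph_nat scaler_nat mulr2n opprD addrACA [- u m + _]addrC.
  rewrite hnorm_scale cmod_real ger0_norm// exprMn.
  move: (dl _ Lc) nd md; set a := n.+1%:R^-1; set b := m.+1%:R^-1.
  by clearbody a b; lra.
have ucvg : cvgn u.
  apply: hcauchy => e e0.
  have [N Ne] : exists N : nat, N.+1%:R^-1 < e ^+ 2 / 4.
    have : (fun n : nat => n.+1%:R^-1 : R) @ \oo --> (0 : R) by exact: cvg_harmonic.
    move=> /cvgrPdist_lt/(_ (e ^+ 2 / 4)).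
    case; first by rewrite divr_gt0 ?exprn_gt0.
    move=> N _ /(_ N (leqnn _)); rewrite sub0r normrN => h.
    by exists N; apply: le_lt_trans h; exact: ler_norm.
  have small n : (N <= n)%N -> n.+1%:R^-1 < e ^+ 2 / 4.
    by move=> Nn; apply: le_lt_trans Ne; rewrite lef_pV2 ?posrE// ler_nat.
  exists N => n m /small hn /small hm.
  rewrite -ltr_sqr ?nnegrE ?hnorm_ge0 ?ltW//.
  apply: le_lt_trans (uu n m) _.
  move: hn hm; set a := n.+1%:R^-1; set b := m.+1%:R^-1.
  by clearbody a b; lra.
have /cvg_ex[p up] := ucvg; exists p.
  move: up; apply: (@closed_cvg _ _ \oo _ u L) => //.
  by apply: nearW => n; exact: (Lu n).1.
move=> l Ll; apply: le_trans (dl _ Ll).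
have h1 : hnorm (x - u n) ^+ 2 @[n --> \oo] --> hnorm (x - p) ^+ 2.
  rewrite expr2; under eq_fun do rewrite expr2.
  by apply: cvgM; apply: hnorm_cvg; apply: cvgB => //; exact: cvg_cst.
have h2 : (d + n.+1%:R^-1) @[n --> \oo] --> d + 0.
  by apply: cvgD; [exact: cvg_cst|exact: cvg_harmonic].
rewrite -[d]addr0; apply: (ler_cvg_to h1 h2).
by apply: nearW => n; apply: ltW; exact: (Lu n).2.
Qed.

(** If the residual q were not orthogonal to l, subtracting from it its
    component along l would give a point of L closer to x. *)
Lemma orthogonal_projection x :
  exists2 p, L p & forall l, L l -> '[x - p, l] = 0.
Proof.
have [p Lp pmin] := closest_point x; exists p => // l Ll.
have [->|l0] := eqVneq l 0; first by rewrite linear0r.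
set q := x - p; pose a := '[q, l] / '[l, l]; pose w := q - a *: l.
have ll0 : '[l, l] != 0 by rewrite dnorm_eq0.
have wl : '[w, l] = 0 by rewrite linearBl/= linearZl_LR/= divfK// subrr.
have qE : '[q, q] = '[w, w] + `|a| ^+ 2 * '[l, l].
  have -> : q = w + a *: l by rewrite subrK.
  move: wl; clearbody w => wl.
  rewrite linearDl/= !linearDr/= linearZl_LR/= !linearZr_LR/= wl mulr0 addr0.
  by rewrite (hdotC l w) wl rmorph0 mulr0 add0r linearZl_LR/= mulrA mulrC -normCKC mulrC.
have : hnorm q ^+ 2 <= hnorm w ^+ 2.
  have -> : w = x - (a *: l + p) by rewrite /w /q opprD addrAC addrA.
  exact/pmin/Llin.
rewrite -lecR !hnorm_sqrE qE gerDl => al.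
have /eqP : `|a| ^+ 2 * '[l, l] = 0.
  by apply/le_anti; rewrite al/= mulr_ge0 ?exprn_ge0 ?dnorm_ge0.
rewrite mulf_eq0 (negPf ll0) orbF expf_eq0/= normr_eq0 => /eqP a0.
by rewrite -[LHS](divfK ll0) -/a a0 mul0r.
Qed.

End Projection.

Section Riesz.
Context (R : realType).
Implicit Types E F : hilbertType R.

(** A vector q orthogonal to the kernel of f represents f up to a scalar, since
    f(q) x - f(x) q lies in the kernel for every x. *)
Lemma riesz E (f : E -> R[i]) (C : R) :
  (forall a x y, f (a *: x + y) = a * f x + f y) ->
  (forall x, cmod (f x) <= C * hnorm x) -> exists w, forall x, f x = '[x, w].
Proof.
move=> flin fC.
have f0 : f 0 = 0.
  by apply: (addrI (f 0)); rewrite addr0 -{1}(mul1r (f 0)) -flin scale1r addr0.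
have fB x y : f (x - y) = f x - f y.
  by rewrite addrC -scaleN1r flin mulN1r addrC.
have fZ a x : f (a *: x) = a * f x by rewrite -[a *: x]addr0 flin f0 addr0.
have [ff0|/existsNP[x0 /eqP fx0]] := pselect (forall x, f x = 0).
  by exists 0 => x; rewrite ff0 linear0r.
have Lcl : closed [set x | f x = 0].
  apply/hclosedP => x xL /=; apply: cmod_eq0; apply/eqP; rewrite eq_le cmod_ge0 andbT.
  apply/ler_addgt0Pl => e e0; rewrite addr0.
  have C0 : 0 < `|C| + 1 by rewrite ltr_wpDl.
  have [|y /= fy0 xy] := xL (e / (`|C| + 1)); first by rewrite divr_gt0.
  rewrite -[f x]subr0 -fy0 -fB; apply: le_trans (fC _) _.
  rewrite ltr_pdivlMr// in xy; apply: ltW; apply: le_lt_trans xy.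
  have := hnorm_ge0 (x - y); have := ler_norm C; nra.
have [|a x y /= fx fy|p /= fp qL] := @orthogonal_projection _ _ _ _ _ Lcl x0.
- by [].
- by rewrite flin fx fy mulr0 addr0.
pose q := x0 - p.
have fq : f q != 0 by rewrite fB fp subr0.
have qq : '[q, q] != 0.
  by rewrite dnorm_eq0; apply: contraNneq fq => ->; rewrite f0.
exists (conjC (f q / '[q, q]) *: q) => x.
rewrite linearZr_LR/= conjCK.
have : '[q, f q *: x - f x *: q] = 0.
  by apply: qL; rewrite /= fB !fZ mulrC subrr.
move=> /(congr1 (@conjC R[i])); rewrite -hdotC rmorph0 linearBl/= !linearZl_LR/=.
move=> /eqP; rewrite subr_eq0 => /eqP fqx.
by rewrite -[LHS](mulfK qq) -fqx -mulrA [X in _ * X]mulrC.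
Qed.

Lemma adjointP E F (T : E -> F) : (forall a x y, T (a *: x + y) = a *: T x + T y) ->
  bounded_op T -> forall x y, '[T x, y] = '[x, adjoint T y].
Proof.
move=> Tlin [C TC] x y.
have [||w wP] := @riesz E (fun x => '[T x, y]) (C * hnorm y).
- by move=> a u v; rewrite Tlin linearDl/= linearZl_LR.
- move=> u; apply: le_trans (hdot_le _ _) _; rewrite mulrAC.
  by rewrite ler_wpM2r ?hnorm_ge0.
rewrite /adjoint; case: xgetP => [z _ /(_ x)//|/(_ w)].
by move=> /(_ wP).
Qed.

(** The form in which adjoints are used: their kernel is the orthogonal
    complement of the range. *)
Lemma nullspace_adjointP E F (T : E -> F) :
  (forall a x y, T (a *: x + y) = a *: T x + T y) -> bounded_op T ->
  nullspace (adjoint T) = [set y | forall x, '[T x, y] = 0].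
Proof.
move=> Tlin Tb; apply/seteqP; split=> y /=.
  by move=> Ty x; rewrite adjointP// Ty linear0r.
move=> Ty; have := adjointP Tlin Tb (adjoint T y) y; rewrite Ty => /esym/eqP.
by rewrite dnorm_eq0 => /eqP.
Qed.

End Riesz.

(** * Shifts and evaluation on the Hardy space *)

Lemma geometric_tail_le (R : realType) (q : R) n m : 0 <= q -> q < 1 ->
  \sum_(n <= j < m) q ^+ j <= q ^+ n / (1 - q).
Proof.
move=> q0 q1; have q1' : 0 < 1 - q by rewrite subr_gt0.
rewrite ler_pdivlMr//.
have [nm|/ltnW mn] := leqP n m; last first.
  by rewrite big_geq// mul0r exprn_ge0.
rewrite -(subnKC nm); elim: (m - n)%N => [|d IH].
  by rewrite addn0 big_geq// mul0r exprn_ge0.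
suff -> : (\sum_(n <= j < n + d.+1) q ^+ j) * (1 - q) = q ^+ n - q ^+ (n + d.+1).
  by rewrite gerBl exprn_ge0.
elim: d.+1 => [|e IHe]; first by rewrite addn0 big_geq// mul0r subrr.
rewrite addnS big_nat_recr ?leq_addr//= mulrDl IHe exprS; ring.
Qed.

Section HardyBasics.
Context (R : realType) (E : hilbertType R).
Implicit Types (f g : hardy E) (a : nat -> E) (z : R[i]).

Lemma hardy_ext f g : (forall n, f n = g n) -> f = g.
Proof. by move=> fg; apply/val_inj/funext. Qed.

Lemma hnorm_hardyE f :
  hnorm f ^+ 2 = limn (series (fun n => hnorm (f n) ^+ 2)).
Proof. by apply: complexI; rewrite -hardy_normE rmorphXn/= -hnormE. Qed.

Lemma hardy_partial_le f N :
  \sum_(0 <= n < N) hnorm (f n) ^+ 2 <= hnorm f ^+ 2.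
Proof. by rewrite hnorm_hardyE; exact: hardy_sum_le. Qed.

Lemma hnorm_coef_le f n : hnorm (f n) <= hnorm f.
Proof. by rewrite -lecR -!hnormE; exact: hardy_coef_le. Qed.

Lemma h2coefs_bounded a (K : R) :
  (forall N, \sum_(0 <= n < N) hnorm (a n) ^+ 2 <= K) -> a \in @h2coefs R E.
Proof.
move=> aK; apply/asboolP.
apply: nondecreasing_is_cvgn; last by exists K => _ [n _ <-]; exact: aK.
by apply/nondecreasing_seqP => m; rewrite /series/= big_nat_recr//= lerDl sqr_ge0.
Qed.

Lemma hnorm_hardy_le f (K : R) : 0 <= K ->
  (forall N, \sum_(0 <= n < N) hnorm (f n) ^+ 2 <= K ^+ 2) -> hnorm f <= K.
Proof.
move=> K0 fK; rewrite -ler_sqr ?nnegrE ?hnorm_ge0// hnorm_hardyE.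
by apply: limr_le; [exact: hardyP|exact: nearW].
Qed.

Let shift_coefs f n := if n is m.+1 then f m else 0.

Lemma shift_coefs_partial f N :
  \sum_(0 <= n < N) hnorm (shift_coefs f n) ^+ 2 <= hnorm f ^+ 2.
Proof.
case: N => [|N]; first by rewrite big_geq// sqr_ge0.
rewrite big_nat_recl//= hnorm0 expr0n/= add0r; exact: hardy_partial_le.
Qed.

Definition hshift f : hardy E := Hardy (h2coefs_bounded (shift_coefs_partial f)).

Lemma back_coefs_partial f N :
  \sum_(0 <= n < N) hnorm (f n.+1) ^+ 2 <= hnorm f ^+ 2.
Proof.
apply: le_trans (hardy_partial_le f N.+1).
by rewrite big_nat_recl//= lerDr sqr_ge0.
Qed.

Definition hback f : hardy E := Hardy (h2coefs_bounded (back_coefs_partial f)).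

Let const_coefs (x : E) n : E := if n is 0%N then x else 0.

Lemma const_coefs_partial x N :
  \sum_(0 <= n < N) hnorm (const_coefs x n) ^+ 2 <= hnorm x ^+ 2.
Proof.
case: N => [|N]; first by rewrite big_geq// sqr_ge0.
rewrite big_nat_recl//= big1 ?addr0// => i _.
by rewrite hnorm0 expr0n.
Qed.

Definition hconst x : hardy E := Hardy (h2coefs_bounded (const_coefs_partial x)).

(** f = f(0) + z (f - f(0))/z: the induction step of most arguments on power
    series below. *)
Lemma hardy_decomp f : f = hconst (f 0%N) + hshift (hback f).
Proof.
apply: hardy_ext => -[|n]; rewrite -[RHS]/(hconst _ _ + hshift _ _)/=.
  by rewrite addr0.
by rewrite add0r.
Qed.

Lemma hback_shift f : hback (hshift f) = f.
Proof. exact: hardy_ext. Qed.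

Lemma hshift_lin (c : R[i]) f g : hshift (c *: f + g) = c *: hshift f + hshift g.
Proof.
apply: hardy_ext => -[|n] //=; rewrite -[RHS]/(c *: (0 : E) + 0).
by rewrite scaler0 addr0.
Qed.

Lemma hback_lin (c : R[i]) f g : hback (c *: f + g) = c *: hback f + hback g.
Proof. exact: hardy_ext. Qed.

Lemma hconst_lin (c : R[i]) x y : hconst (c *: x + y) = c *: hconst x + hconst y.
Proof.
apply: hardy_ext => -[|n] //=; rewrite -[RHS]/(c *: (0 : E) + 0).
by rewrite scaler0 addr0.
Qed.

HB.instance Definition _ := GRing.isLinear.Build _ _ _ _ hshift hshift_lin.
HB.instance Definition _ := GRing.isLinear.Build _ _ _ _ hback hback_lin.
HB.instance Definition _ := GRing.isLinear.Build _ _ _ _ hconst hconst_lin.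

Lemma hnorm_back f : hnorm (hback f) <= hnorm f.
Proof.
by apply: hnorm_hardy_le; [exact: hnorm_ge0|exact: back_coefs_partial].
Qed.

Lemma hnorm_shift f : hnorm (hshift f) = hnorm f.
Proof.
apply/le_anti/andP; split.
  by apply: hnorm_hardy_le; [exact: hnorm_ge0|exact: shift_coefs_partial].
by rewrite -{1}(hback_shift f); exact: hnorm_back.
Qed.

Lemma hnorm_const x : hnorm (hconst x) = hnorm x.
Proof.
apply/le_anti/andP; split; last exact: (hnorm_coef_le (hconst x) 0).
by apply: hnorm_hardy_le; [exact: hnorm_ge0|exact: const_coefs_partial].
Qed.

Lemma hdot_cvg f g :
  (fun N => \sum_(0 <= n < N) '[f n, g n] : R[i]^o) @ \oo --> ('[f, g] : R[i]^o).
Proof. exact: hardy_dot_cvg. Qed.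

(** The index is shifted by one because the first term of the series is the one
    that is split off. *)
Lemma hdot_unique f g (l : R[i]) :
  (fun N => \sum_(0 <= n < N.+1) '[f n, g n] : R[i]^o) @ \oo --> (l : R[i]^o) ->
  '[f, g] = l.
Proof.
set u : nat -> R[i]^o := fun N => \sum_(0 <= n < N) '[f n, g n].
move=> fgl; have ul : u @ \oo --> (l : R[i]^o) by rewrite -cvg_shiftS.
have fgu : u @ \oo --> ('[f, g] : R[i]^o) by exact: hdot_cvg.
exact: (@cvg_unique R[i]^o (@norm_hausdorff _ R[i]^o) _ _ _ _ fgu ul).
Qed.

Lemma hdot_shift f g : '[hshift f, g] = '[f, hback g].
Proof.
apply: hdot_unique; apply: cvg_trans (@hdot_cvg f (hback g)).
apply: near_eq_cvg; apply: nearW => n /=.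
by rewrite big_nat_recl//= linear0l add0r.
Qed.

Lemma hardy_eval_tail f z n m : cmod z < 1 ->
  hnorm (\sum_(n <= j < m) z ^+ j *: f j) <= hnorm f * (cmod z ^+ n / (1 - cmod z)).
Proof.
move=> z1; apply: le_trans (hnorm_sum _ _ _) _.
apply: (@le_trans _ _ (hnorm f * \sum_(n <= j < m) cmod z ^+ j)).
  rewrite mulr_sumr; apply: ler_sum => j _.
  rewrite hnorm_scale cmodX mulrC; apply: ler_wpM2r (hnorm_coef_le f j).
  by rewrite exprn_ge0// cmod_ge0.
by rewrite ler_wpM2l ?hnorm_ge0// geometric_tail_le ?cmod_ge0.
Qed.

Lemma hardy_eval_cvg f z : cmod z < 1 ->
  series (fun n => z ^+ n *: f n) @ \oo --> hardy_eval f z.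
Proof.
move=> z1; suff : cvgn (series (fun n => z ^+ n *: f n)) by [].
have z1' : 0 < 1 - cmod z by rewrite subr_gt0.
apply: hcauchy => e e0.
have [N Ne] : exists N : nat, hnorm f * (cmod z ^+ N / (1 - cmod z)) < e.
  have : (fun n => hnorm f / (1 - cmod z) * cmod z ^+ n) @ \oo -->
      hnorm f / (1 - cmod z) * 0.
    apply: cvgM; first exact: cvg_cst.
    apply: cvg_expr; by rewrite ger0_norm// cmod_ge0.
  rewrite mulr0 => /cvgrPdist_lt/(_ e e0)[N _ /(_ N (leqnn _))].
  rewrite sub0r normrN => h; exists N; apply: le_lt_trans h.
  by apply: le_trans (ler_norm _); rewrite mulrA mulrAC.
exists N.
have wlog_nm n m : (N <= n)%N -> (n <= m)%N ->
    hnorm (series (fun n => z ^+ n *: f n) n - series (fun n => z ^+ n *: f n) m) < e.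
  move=> Nn nm; rewrite hnorm_distC sub_series_geq//.
  apply: le_lt_trans (hardy_eval_tail _ _ _ z1) _; apply: le_lt_trans Ne.
  apply: ler_wpM2l; first exact: hnorm_ge0.
  apply: ler_wpM2r; first by rewrite invr_ge0 ltW.
  by apply: ler_wiXn2l => //; [exact: cmod_ge0|exact: ltW].
move=> n m Nn Nm; have [nm|/ltnW mn] := leqP n m; first exact: wlog_nm.
by rewrite hnorm_distC; exact: wlog_nm.
Qed.

Lemma hardy_eval_unique f z l : cmod z < 1 ->
  series (fun n => z ^+ n *: f n) @ \oo --> l -> hardy_eval f z = l.
Proof.
by move=> z1; apply: cvg_unique (@hardy_eval_cvg f z z1); exact: norm_hausdorff.
Qed.

Lemma hardy_eval_lin z (c : R[i]) f g : cmod z < 1 ->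
  hardy_eval (c *: f + g) z = c *: hardy_eval f z + hardy_eval g z.
Proof.
move=> z1; apply: hardy_eval_unique => //.
have -> : series (fun n => z ^+ n *: (c *: f + g) n) =
    (fun N => c *: series (fun n => z ^+ n *: f n) N + series (fun n => z ^+ n *: g n) N).
  apply/funext => N; rewrite /series/= scaler_sumr -big_split/=.
  apply: eq_bigr => n _; rewrite -[(_ + _) n]/(c *: f n + g n).
  by rewrite scalerDr !scalerA mulrC.
by apply: cvgD; [apply: cvgZ => //; first exact: cvg_cst|]; exact: hardy_eval_cvg.
Qed.

Lemma hardy_eval_const x z : cmod z < 1 -> hardy_eval (hconst x) z = x.
Proof.
move=> z1; apply: hardy_eval_unique => //; rewrite -(cvg_shiftS _).
apply: cvg_near_cst; apply: nearW => n /=.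
rewrite /series/= big_nat_recl//= expr0 scale1r big1 ?addr0// => i _.
by rewrite scaler0.
Qed.

Lemma hardy_eval_shift f z : cmod z < 1 ->
  hardy_eval (hshift f) z = z *: hardy_eval f z.
Proof.
move=> z1; apply: hardy_eval_unique => //; rewrite -(cvg_shiftS _).
have -> : (fun n => series (fun n => z ^+ n *: hshift f n) n.+1) =
    (fun N => z *: series (fun n => z ^+ n *: f n) N).
  apply/funext => N; rewrite /series/= big_nat_recl//= scaler0 add0r scaler_sumr.
  by apply: eq_bigr => i _; rewrite scalerA -exprS.
by apply: cvgZ => //; [exact: cvg_cst|]; exact: hardy_eval_cvg.
Qed.

Lemma hnorm_eval_le f z : cmod z < 1 ->
  hnorm (hardy_eval f z) <= hnorm f / (1 - cmod z).
Proof.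
move=> z1; apply: (cvgr_to_le (hnorm_cvg _ (@hardy_eval_cvg f z z1))).
apply: nearW => N; rewrite /series/=.
by apply: le_trans (hardy_eval_tail _ _ _ z1) _; rewrite expr0 mul1r.
Qed.

Lemma hardy_eval0 f : hardy_eval f 0 = f 0%N.
Proof.
have z1 : cmod (0 : R[i]) < 1 by rewrite -cmod_lt1 normr0.
by rewrite {1}(hardy_decomp f) -[X in X + _]scale1r hardy_eval_lin// hardy_eval_shift//
  scale0r addr0 scale1r hardy_eval_const.
Qed.

End HardyBasics.

(** * Discrete Parseval identity *)

Lemma primitive_root_exists (C : numClosedFieldType) n : (0 < n)%N ->
  exists w : C, n.-primitive_root w.
Proof.
move=> n0; have [r] := closed_field_poly_normal ('X^n - 1 : {poly C}).
rewrite (monicP _) ?monicXnsubC// scale1r => rE.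
have /hasP[w _ wP] : has n.-primitive_root r; last by exists w.
apply: cyclic.has_prim_root => //.
- by apply/allP => w; rewrite -root_prod_XsubC -rE.
- rewrite -separable.separable_prod_XsubC -rE.
  by rewrite cyclotomic.separable_Xn_sub_1// pnatr_eq0 -lt0n.
- by rewrite -ltnS -(size_prod_XsubC r id) -rE size_XnsubC.
Qed.

Section Parseval.
Context (R : realType) (E : hilbertType R).

Lemma primitive_root_norm n (w : R[i]) : n.-primitive_root w -> `|w| = 1.
Proof.
move=> wn; have n0 := prim_order_gt0 wn.
apply/eqP; rewrite -(@pexpr_eq1 _ _ n)//.
by rewrite -normrX (prim_expr_order wn) normr1.
Qed.

Lemma primitive_root_orthogonality N (w : R[i]) m l : N.-primitive_root w ->
  (m < N)%N -> (l < N)%N ->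
  \sum_(0 <= s < N) (w ^+ (s * m) * conjC (w ^+ (s * l))) =
  if m == l then N%:R else 0.
Proof.
move=> wN mN lN.
have ww : w * conjC w = 1 by rewrite -normCK (primitive_root_norm wN) expr1n.
pose zeta := w ^+ m * conjC w ^+ l.
have -> : \sum_(0 <= s < N) (w ^+ (s * m) * conjC (w ^+ (s * l))) =
    \sum_(0 <= s < N) zeta ^+ s.
  by apply: eq_bigr => s _; rewrite exprMn -!exprM rmorphXn/= !(mulnC s).
case: eqVneq => [ml|ml].
  rewrite /zeta ml -exprMn ww expr1n.
  by under eq_bigr do rewrite expr1n; rewrite sumr_const_nat subn0.
have zN : zeta ^+ N = 1.
  rewrite exprMn exprAC [in X in _ * X]exprAC -rmorphXn/=.
  by rewrite (prim_expr_order wN) rmorph1 !expr1n mulr1.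
have z1 : zeta - 1 != 0.
  rewrite subr_eq0; apply: contra ml => /eqP z1.
  have : w ^+ m = w ^+ l.
    by rewrite -[RHS]mul1r -z1 /zeta -mulrA -exprMn [conjC w * w]mulrC ww expr1n mulr1.
  by move=> /eqP; rewrite (eq_prim_root_expr wN) !modn_small.
by apply: (mulfI z1); rewrite mulr0 big_mkord -subrX1 zN subrr.
Qed.

(** The average over N-th roots of unity replaces the integral over a circle,
    and is exact for polynomials of degree less than N. *)
Lemma discrete_parseval N (w : R[i]) (p : nat -> E) : N.-primitive_root w ->
  \sum_(0 <= s < N) hnorm (\sum_(0 <= m < N) w ^+ (s * m) *: p m) ^+ 2 =
  N%:R * \sum_(0 <= m < N) hnorm (p m) ^+ 2.
Proof.
move=> wN; apply: complexI; rewrite rmorphM rmorph_nat !rmorph_sum/=.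
under eq_bigr => s _.
  rewrite hnorm_sqrE linear_sumlz/=.
  under eq_bigr => m _.
    rewrite linear_sumr/=.
    under eq_bigr => l _ do rewrite linearZl_LR/= linearZr_LR/= mulrA.
    over.
  over.
rewrite exchange_big/= mulr_sumr big_nat [RHS]big_nat.
apply: eq_bigr => m /andP[_ mN].
rewrite exchange_big/= (bigD1_seq m) ?mem_index_iota ?iota_uniq//=.
rewrite -mulr_suml primitive_root_orthogonality// eqxx hnorm_sqrE.
rewrite big_nat_cond big1 ?addr0// => l /andP[/andP[_ lN] lm].
by rewrite -mulr_suml primitive_root_orthogonality// eq_sym (negPf lm) mul0r.
Qed.

End Parseval.

(** * Cauchy products *)

Section Regroup.
Context (K : pzRingType) (V : lmodType K).
Implicit Types (T : nat -> nat -> V).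

Lemma sum_antidiagonal (z : K) T n M :
  \sum_(0 <= j < n) \sum_(0 <= l < M) z ^+ (j + l) *: T j l =
  \sum_(0 <= m < n + M)
     z ^+ m *: \sum_(0 <= j < n) \sum_(0 <= l < M | (j + l)%N == m) T j l.
Proof.
under [RHS]eq_bigr => m _.
  rewrite scaler_sumr; under eq_bigr => j _ do rewrite scaler_sumr big_mkcond/=.
  over.
rewrite [RHS]exchange_big/= big_nat [RHS]big_nat; apply: eq_bigr => j /andP[_ jn].
rewrite [RHS]exchange_big/= big_nat [RHS]big_nat; apply: eq_bigr => l /andP[_ lM].
rewrite (bigD1_seq (j + l)%N) ?iota_uniq ?mem_index_iota //= ?eqxx; last by lia.
by rewrite big1 ?addr0// => i; rewrite eq_sym => /negPf ->.
Qed.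

(** Below both cutoffs an antidiagonal is complete, so truncation does not alter
    the coefficient of a Cauchy product. *)
Lemma sum_antidiagonal_low T n M m : (m < M)%N -> (m < n)%N ->
  \sum_(0 <= j < n) \sum_(0 <= l < M | (j + l)%N == m) T j l =
  \sum_(0 <= j < m.+1) T j (m - j)%N.
Proof.
move=> mM mn; rewrite (big_cat_nat (leq0n m.+1) mn)/= [X in _ + X]big_nat_cond.
rewrite [X in _ + X]big1 ?addr0; last first.
  move=> j /andP[/andP[mj _] _]; rewrite big1// => l /eqP jl; lia.
rewrite big_nat [RHS]big_nat; apply: eq_bigr => j /andP[_ jm].
rewrite big_mkcond/= (bigD1_seq (m - j)%N) ?iota_uniq ?mem_index_iota //=; last by lia.
rewrite subnKC// eqxx big1 ?addr0// => i im.
by case: eqP => // jim; lia.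
Qed.

End Regroup.

(** * Bounded symbols act boundedly on coefficients *)

Section Coefficients.
Context (R : realType) (E F : hilbertType R).
Context (Phi : R[i] -> {linear E -> F}) (A : nat -> {linear E -> F}) (C : R).
Context (C0 : 0 <= C).
Context (PhiC : forall z, `|z| < 1 -> forall x, hnorm (Phi z x) <= C * hnorm x).
Context (A_bounded : forall n, bounded_op (A n)).
Context (PhiA : forall z, `|z| < 1 -> forall e : R, 0 < e ->
  \forall n \near \oo, forall x,
    hnorm (Phi z x - \sum_(0 <= j < n) z ^+ j *: A j x) <= e * hnorm x).

Lemma coefs_prefix_bounded N : exists2 K : R, 0 <= K &
  forall j, (j < N)%N -> forall x, hnorm (A j x) <= K * hnorm x.
Proof.
elim: N => [|N [K K0 KA]]; first by exists 0.
have [D DA] := A_bounded N.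
exists (K + `|D|); first by rewrite addr_ge0.
move=> j; rewrite ltnS leq_eqVlt => /predU1P[->|jN] x.
  apply: le_trans (DA x) _; rewrite ler_wpM2r ?hnorm_ge0//.
  by apply: le_trans (ler_norm _) _; rewrite lerDr.
apply: le_trans (KA _ jN x) _; rewrite ler_wpM2r ?hnorm_ge0//.
by rewrite lerDl.
Qed.

(** At the single point z = rho the partial sums are within ||x|| of their limit
    from some index on, so consecutive ones differ by at most 2 ||x||; the
    finitely many earlier coefficients are bounded one by one. *)
Lemma cauchy_estimate (rho : R) : 0 <= rho -> rho < 1 -> exists2 K : R, 0 <= K &
  forall j x, rho ^+ j * hnorm (A j x) <= K * hnorm x.
Proof.
move=> r0 r1; have rz : cmod (rho%:C : R[i]) = rho by rewrite cmod_real ger0_norm.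
have [|N _ NA] := @PhiA (rho%:C) _ 1 ltr01; first by rewrite cmod_lt1 rz.
have [K K0 KA] := coefs_prefix_bounded N.
exists (K + 2) => [|j x]; first by rewrite addr_ge0.
have [jN|Nj] := ltnP j N.
  apply: (@le_trans _ _ (K * hnorm x)); last first.
    by rewrite ler_wpM2r ?hnorm_ge0// lerDl.
  apply: le_trans (KA _ jN x); rewrite ler_piMl ?hnorm_ge0//.
  by rewrite exprn_ile1// ltW.
have -> : rho ^+ j * hnorm (A j x) = hnorm ((rho%:C : R[i]) ^+ j *: A j x).
  by rewrite hnorm_scale cmodX rz.
have hj := NA j Nj x; have hj1 := NA j.+1 (leqW Nj) x.
rewrite big_nat_recr//= in hj1; rewrite !mul1r in hj hj1.
set a := (X in hnorm X <= _) in hj; set b := rho%:C ^+ j *: A j x in hj1 *.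
have -> : b = a - (a - b) by rewrite opprB addrC subrK.
rewrite opprD addrA -/a in hj1.
apply: le_trans (Defs.hnormD _ _) _; rewrite hnorm_opp.
by have := hnorm_ge0 x; nra.
Qed.

(** Convergence is assumed pointwise in z. The estimate at the larger radius
    (1 + r)/2 dominates the tails by a geometric series, uniformly on the circle
    of radius r; uniformity is needed because the number of sample points on
    the circle grows with the length of the partial sum. *)
Lemma partial_sums_uniform (r e : R) : 0 <= r -> r < 1 -> 0 < e ->
  exists N, forall n, (N <= n)%N -> forall z, cmod z = r -> forall x,
    hnorm (Phi z x - \sum_(0 <= j < n) z ^+ j *: A j x) <= e * hnorm x.
Proof.
move=> r0 r1 e0; pose rho := (1 + r) / 2.
have rho0 : 0 < rho by rewrite /rho; lra.
have rho1 : rho < 1 by rewrite /rho; lra.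
have [K K0 KA] := cauchy_estimate (ltW rho0) rho1.
pose q := r / rho.
have q0 : 0 <= q by rewrite divr_ge0// ltW.
have q1 : q < 1 by rewrite ltr_pdivrMr// mul1r /rho; lra.
have rq j : r ^+ j = q ^+ j * rho ^+ j by rewrite -exprMn divfK// gt_eqF.
have [N Nq] : exists N : nat, forall n, (N <= n)%N -> K * (q ^+ n / (1 - q)) <= e / 2.
  have : (fun n => K / (1 - q) * q ^+ n) @ \oo --> K / (1 - q) * 0.
    apply: cvgM; first exact: cvg_cst.
    by apply: cvg_expr; rewrite ger0_norm.
  rewrite mulr0 => /cvgrPdist_le/(_ (e / 2)); case; first by rewrite divr_gt0.
  move=> N _ NK; exists N => n Nn; apply: le_trans (NK n Nn).
  rewrite sub0r normrN; apply: le_trans (ler_norm _).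
  by rewrite mulrA mulrAC.
exists N => n Nn z zr x.
have z1 : `|z| < 1 by rewrite cmod_lt1 zr.
have e20 : 0 < e / 2 by rewrite divr_gt0.
have [m0 _ mA] := PhiA z1 e20.
pose m := maxn n m0.
have nm : (n <= m)%N by exact: leq_maxl.
have := mA m (leq_maxr _ _) x.
rewrite [X in _ - X](big_cat_nat (leq0n n) nm)/= opprD addrA.
set a := Phi z x - _; set b := \sum_(n <= j < m) _ => ab.
have hb : hnorm b <= e / 2 * hnorm x.
  apply: le_trans (hnorm_sum _ _ _) _.
  apply: (@le_trans _ _ (\sum_(n <= j < m) q ^+ j * (K * hnorm x))).
    apply: ler_sum => j _; rewrite hnorm_scale cmodX zr rq -mulrA.
    by rewrite ler_wpM2l ?exprn_ge0.
  rewrite -mulr_suml mulrA ler_wpM2r ?hnorm_ge0//.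
  apply: le_trans (Nq n Nn); rewrite mulrC ler_wpM2l//.
  exact: geometric_tail_le.
rewrite -[a](subrK b); apply: le_trans (Defs.hnormD _ _) _.
rewrite [e in leRHS]splitr mulrDl; exact: lerD.
Qed.

Definition conv_coef (h : nat -> E) (m : nat) : F :=
  \sum_(0 <= j < m.+1) A j (h (m - j)%N).

(** Let Phi_n be a partial sum within e of Phi on the circle of radius r, so that
    |Phi_n| is at most C + e there. For the polynomial H with coefficients h_m,
    m < M, both H and Phi_n H have degree less than N = n + M + 1, so Parseval
    over N-th roots of unity converts |Phi_n H| <= (C + e) |H| at the sample
    points into the inequality between sums of squares. The first M
    coefficients of Phi_n H are those of the full Cauchy product as n >= M. *)
Lemma conv_coef_le_radius (r e : R) (h : nat -> E) M : 0 <= r -> r < 1 -> 0 < e ->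
  \sum_(0 <= m < M) (r ^+ m * hnorm (conv_coef h m)) ^+ 2 <=
  (C + e) ^+ 2 * \sum_(0 <= m < M) hnorm (h m) ^+ 2.
Proof.
move=> r0 r1 e0; have [N0 N0A] := partial_sums_uniform r0 r1 e0.
pose n := maxn N0 M; pose N := (n + M).+1.
have [w wN] := @primitive_root_exists R[i] N (ltn0Sn _).
pose z s : R[i] := r%:C * w ^+ s.
have zr s : cmod (z s) = r.
  rewrite cmodM cmod_real ger0_norm// cmodX.
  have -> : cmod w = 1 by apply: complexI; rewrite -cmodE (primitive_root_norm wN).
  by rewrite expr1n mulr1.
have zE s m : (z s) ^+ m = w ^+ (s * m) * (r ^+ m)%:C.
  by rewrite exprMn -exprM rmorphXn mulrC.
pose p m : F := \sum_(0 <= j < n) \sum_(0 <= l < M | (j + l)%N == m) A j (h l).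
have pE m : (m < M)%N -> p m = conv_coef h m.
  move=> mM; rewrite /p (sum_antidiagonal_low (fun j l => A j (h l)))//.
  by rewrite (leq_trans mM)// leq_maxr.
(* h cut off at M, so that H becomes a sum of N terms as Parseval requires *)
pose ht m := if (m < M)%N then h m else 0.
pose H s : E := \sum_(0 <= l < M) z s ^+ l *: h l.
have HE s : H s = \sum_(0 <= l < N) w ^+ (s * l) *: ((r ^+ l)%:C *: ht l).
  rewrite /H (@big_nat_widen _ _ _ 0 M N) /=; last by rewrite /N; lia.
  rewrite big_mkcond/=; apply: eq_bigr => l _; rewrite /ht.
  by case: ifP => _; rewrite ?scaler0// scalerA zE.
pose G s : F := \sum_(0 <= m < N) w ^+ (s * m) *: ((r ^+ m)%:C *: p m).
have GE s : G s = \sum_(0 <= j < n) z s ^+ j *: A j (H s).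
  transitivity (\sum_(0 <= j < n) \sum_(0 <= l < M) z s ^+ (j + l) *: A j (h l)).
    rewrite (sum_antidiagonal _ (fun j l => A j (h l))) /G /N big_nat_recr//=.
    rewrite [X in _ + X](_ : _ = 0) ?addr0.
      by apply: eq_bigr => m _; rewrite scalerA zE.
    rewrite [p _](_ : _ = 0) ?scaler0// /p big_nat big1// => j /andP[_ jn].
    by rewrite big_nat_cond big1// => l /andP[/andP[_ lM] /eqP]; lia.
  apply: eq_bigr => j _; rewrite /H linear_sum/= scaler_sumr.
  by apply: eq_bigr => l _; rewrite linearZ/= scalerA exprD.
have GH s : hnorm (G s) <= (C + e) * hnorm (H s).
  have z1 : `|z s| < 1 by rewrite cmod_lt1 zr.
  rewrite GE; have := N0A n (leq_maxl _ _) (z s) (zr s) (H s).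
  set S := \sum_(0 <= j < n) _ => SH.
  rewrite -[S](subKr (Phi (z s) (H s))); apply: le_trans (Defs.hnormD _ _) _.
  by rewrite hnorm_opp mulrDl lerD// PhiC.
have Ce0 : 0 <= C + e by rewrite addr_ge0// ltW.
have NR : 0 < (N%:R : R) by rewrite ltr0n.
have : \sum_(0 <= s < N) hnorm (G s) ^+ 2 <=
    (C + e) ^+ 2 * \sum_(0 <= s < N) hnorm (H s) ^+ 2.
  rewrite mulr_sumr; apply: ler_sum => s _; rewrite -exprMn.
  by rewrite ler_sqr ?nnegrE ?mulr_ge0 ?hnorm_ge0.
under [X in _ * X]eq_bigr do rewrite HE.
rewrite !discrete_parseval// mulrCA ler_pM2l// => GHs.
apply: le_trans (le_trans _ GHs) _.
  rewrite [leRHS](@big_cat_nat _ _ _ M)//=; last by rewrite /N; lia.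
  rewrite -[leLHS]addr0; apply: lerD; last by apply: sumr_ge0 => *; exact: sqr_ge0.
  rewrite le_eqVlt; apply/orP; left; apply/eqP.
  rewrite big_nat [RHS]big_nat; apply: eq_bigr => m /andP[_ mM].
  by rewrite hnorm_scale cmod_real ger0_norm ?exprn_ge0// pE.
rewrite ler_wpM2l ?sqr_ge0//.
rewrite (@big_cat_nat _ _ _ M)//=; last by rewrite /N; lia.
rewrite [X in _ + X]big_nat [X in _ + X]big1 ?addr0.
  rewrite big_nat [leRHS]big_nat; apply: ler_sum => m /andP[_ mM].
  rewrite /ht mM hnorm_scale cmod_real ger0_norm ?exprn_ge0//.
  rewrite ler_sqr ?nnegrE ?mulr_ge0 ?hnorm_ge0 ?exprn_ge0//.
  by rewrite ler_piMl ?hnorm_ge0// exprn_ile1// ltW.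
move=> m /andP[Mm _]; rewrite /ht ltnNge Mm/= scaler0 hnorm0 expr0n//.
Qed.

(** Let r tend to 1 in the previous bound, with e = 1 - r. *)
Lemma conv_coef_le (h : nat -> E) M :
  \sum_(0 <= m < M) hnorm (conv_coef h m) ^+ 2 <=
  C ^+ 2 * \sum_(0 <= m < M) hnorm (h m) ^+ 2.
Proof.
set X := (X in X <= _); set Y := (X in _ <= _ * X).
have fX : (r ^+ M) ^+ 2 * X @[r --> 1^'-] --> (1 ^+ M) ^+ 2 * X.
  apply: cvg_at_left_filter; apply: cvgM; last exact: cvg_cst.
  rewrite !expr2; under eq_fun do rewrite expr2.
  by apply: cvgM; exact: exprn_continuous.
have gY : (C + (1 - r)) ^+ 2 * Y @[r --> 1^'-] --> (C + (1 - 1)) ^+ 2 * Y.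
  apply: cvg_at_left_filter; apply: cvgM; last exact: cvg_cst.
  rewrite !expr2; under eq_fun do rewrite expr2.
  by apply: cvgM; apply: cvgD; try exact: cvg_cst;
    apply: cvgB; try exact: cvg_cst; exact: cvg_id.
rewrite -[leLHS]mul1r -(expr1n _ 2) -[in leLHS](expr1n _ M) -[C in leRHS]addr0 -(subrr 1).
apply: (ler_cvg_to fX gY).
near=> r.
have r0 : 0 < r by near: r; exact: nbhs_left_gt.
have r1 : r < 1 by near: r; exact: nbhs_left_lt.
apply: le_trans (@conv_coef_le_radius r (1 - r) h M (ltW r0) r1 _);
  last by rewrite subr_gt0.
rewrite mulr_sumr big_nat [leRHS]big_nat; apply: ler_sum => m /andP[_ mM].
have r0' := ltW r0.
rewrite -exprMn ler_sqr ?nnegrE ?mulr_ge0 ?hnorm_ge0 ?exprn_ge0//.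
rewrite ler_wpM2r ?hnorm_ge0//.
by apply: ler_wiXn2l; [|exact: ltW|exact: ltnW].
Unshelve. all: by end_near. Qed.

End Coefficients.

(** * Analytic Toeplitz operators *)

Section Uniqueness.
Context (R : realType) (E : hilbertType R).
Implicit Types (f g : hardy E).

Lemma iter_hback_coef n f m : iter n (@hback R E) f m = f (m + n)%N.
Proof.
by elim: n m => [|n IH] m /=; [rewrite addn0|rewrite IH addSnnS].
Qed.

Lemma hnorm_iter_back n f : hnorm (iter n (@hback R E) f) <= hnorm f.
Proof. by elim: n => //= n; apply: le_trans; exact: hnorm_back. Qed.

Lemma hardy_eval_decomp f z : cmod z < 1 ->
  hardy_eval f z = f 0%N + z *: hardy_eval (hback f) z.
Proof.
move=> z1; rewrite {1}(hardy_decomp f) -[hconst _]scale1r hardy_eval_lin// scale1r.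
by rewrite hardy_eval_const// hardy_eval_shift.
Qed.

(** Identity theorem. The value f(0) = - z g(z), with g the backward shift of f,
    is arbitrarily small as z tends to 0; then g vanishes at every z <> 0 as
    well, and the argument repeats. The point z = 0 is excluded since dividing
    by z loses it. *)
Lemma hardy_eval_eq0 f :
  (forall z, z != 0 -> cmod z < 1 -> hardy_eval f z = 0) -> f = 0.
Proof.
have head0 g : (forall z, z != 0 -> cmod z < 1 -> hardy_eval g z = 0) -> g 0%N = 0.
  move=> gz; apply: hnorm_eq0; apply/eqP; rewrite eq_le hnorm_ge0 andbT leNgt.
  apply/negP; set a := hnorm (g 0%N) => a0.
  have K0 := hnorm_ge0 (hback g); set K := hnorm (hback g) in K0.
  (* at radius t <= 1/2 the bound is t K / (1 - t) <= 2 t K = a K / (a + K) < a *)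
  pose t := a / (2 * (a + K)).
  have aK : 0 < a + K by rewrite ltr_wpDr.
  have t0 : 0 < t by rewrite divr_gt0// mulr_gt0.
  have tE : t * (2 * (a + K)) = a by rewrite divfK// mulf_neq0// gt_eqF.
  have t2 : t <= 1 / 2 by nra.
  have tz : cmod (t%:C : R[i]) = t by rewrite cmod_real gtr0_norm.
  have t1 : cmod (t%:C : R[i]) < 1 by rewrite tz; lra.
  have : g 0%N = - ((t%:C : R[i]) *: hardy_eval (hback g) t%:C).
    apply/eqP; rewrite -addr_eq0 -hardy_eval_decomp// gz//.
    by rewrite gt_eqF// ltcR.
  move=> /(congr1 (@hnorm R E)); rewrite hnorm_opp hnorm_scale tz -/a => aE.
  have := hnorm_eval_le (hback g) t1; rewrite tz -/K ler_pdivlMr; last by lra.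
  set b := hnorm _ in aE *; have := hnorm_ge0 (hardy_eval (hback g) t%:C : E).
  rewrite -/b => b0 bK.
  have : a * (1 - t) <= t * K by rewrite aE -mulrA ler_wpM2l// ltW.
  nra.
move=> fz; apply: hardy_ext => n.
have -> : f n = iter n (@hback R E) f 0%N by rewrite iter_hback_coef.
apply: (head0 (iter n _ f)); elim: n => //= n IH z z0 z1.
have := hardy_eval_decomp (iter n (@hback R E) f) z1.
rewrite (head0 _ IH) IH// add0r => /esym/eqP.
by rewrite scaler_eq0 (negPf z0) => /eqP.
Qed.

Lemma hardy_eval_inj f g :
  (forall z, cmod z < 1 -> hardy_eval f z = hardy_eval g z) -> f = g.
Proof.
move=> fg; apply/eqP; rewrite -subr_eq0; apply/eqP/hardy_eval_eq0 => z _ z1.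
by rewrite addrC -scaleN1r hardy_eval_lin// fg// scaleN1r addNr.
Qed.

End Uniqueness.

Section Toeplitz.
Context (R : realType) (E F : hilbertType R).
Context (Phi : R[i] -> {linear E -> F}) (C : R) (C0 : 0 <= C).
Context (PhiC : forall z, `|z| < 1 -> forall x, hnorm (Phi z x) <= C * hnorm x).
Context (Phi_an : analytic_on_disc Phi).

(** The multiplier T is the Cauchy product with the coefficients of Phi. That
    (T h)(z) = Phi(z) h(z) is the vanishing of the defect D. It is zero on
    constants by the power series of Phi, and T commutes with the shift, whence
    D h = z D(hback h). Iterating, |D h| <= |z|^n K |h| for all n, since hback
    is a contraction. *)
Lemma multiplier_exists (h : hardy E) : exists2 g : hardy F,
  hnorm g <= C * hnorm h &
  forall z, cmod z < 1 -> hardy_eval g z = Phi z (hardy_eval h z).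
Proof.
have [A Ab PhiA] := Phi_an.
have partial (f : hardy E) N :
    \sum_(0 <= m < N) hnorm (conv_coef A f m) ^+ 2 <= (C * hnorm f) ^+ 2.
  apply: le_trans (conv_coef_le C0 PhiC Ab PhiA f N) _.
  by rewrite exprMn ler_wpM2l ?sqr_ge0//; exact: hardy_partial_le.
pose T (f : hardy E) : hardy F := Hardy (h2coefs_bounded (partial f)).
have Tle f : hnorm (T f) <= C * hnorm f.
  by apply: hnorm_hardy_le; [rewrite mulr_ge0 ?hnorm_ge0|exact: partial].
exists (T h) => // z z1.
have TE f m : T f m = \sum_(0 <= j < m.+1) A j (f (m - j)%N) by [].
have Tlin c f g : T (c *: f + g) = c *: T f + T g.
  apply: hardy_ext => m; rewrite -[RHS]/(c *: T f m + T g m) !TE.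
  rewrite scaler_sumr -big_split/=; apply: eq_bigr => j _.
  exact: (linearP (A j) c (f (m - j)%N) (g (m - j)%N)).
have Tshift f : T (hshift f) = hshift (T f).
  apply: hardy_ext => -[|m].
    by rewrite TE big_nat1/= linear0.
  rewrite TE big_nat_recr//= subnn linear0 addr0 -[RHS]/(T f m) TE.
  rewrite big_nat [RHS]big_nat; apply: eq_bigr => j /andP[_ jm].
  by rewrite subSn.
have Tconst x m : T (hconst x) m = A m x.
  rewrite TE big_nat_recr//= subnn big_nat big1 ?add0r// => j /andP[_ jm].
  by rewrite -(subnSK jm) /= linear0.
pose D f := hardy_eval (T f) z - Phi z (hardy_eval f z).
have z1' : 0 < 1 - cmod z by rewrite subr_gt0.
have Dconst x : D (hconst x) = 0.
  apply/eqP; rewrite subr_eq0 hardy_eval_const//; apply/eqP.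
  apply: hardy_eval_unique => //; apply/hcvgP => e e0.
  have e0' : 0 < e / (hnorm x + 1) by rewrite divr_gt0// ltr_wpDl ?hnorm_ge0.
  have z1C : `|z| < 1 by rewrite cmod_lt1.
  have [N _ NA] := PhiA z z1C _ e0'; exists N => // n /NA /(_ x) /= nA.
  have -> : series (fun j => z ^+ j *: T (hconst x) j) n =
      \sum_(0 <= j < n) z ^+ j *: A j x.
    by apply: eq_bigr => j _; rewrite Tconst.
  apply: le_lt_trans nA _; rewrite -mulrA -[ltRHS]mulr1 ltr_pM2l//.
  by rewrite mulrC ltr_pdivrMr ?mul1r ?ltrDl// ltr_wpDl ?hnorm_ge0.
have Dback f : D f = z *: D (hback f).
  have fE : f = 1 *: hconst (f 0%N) + hshift (hback f).
    by rewrite scale1r -hardy_decomp.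
  rewrite {1}/D {1 2}fE Tlin Tshift !hardy_eval_lin// !hardy_eval_shift// !scale1r.
  rewrite linearD/= linearZ/= opprD addrACA -scalerBr.
  by rewrite -[X in X + _]/(D (hconst (f 0%N))) Dconst add0r.
have Dle f : hnorm (D f) <= (2 * C / (1 - cmod z)) * hnorm f.
  apply: le_trans (Defs.hnormD _ _) _; rewrite hnorm_opp.
  have h1 := hnorm_eval_le (T f) z1; have h2 := hnorm_eval_le f z1.
  have z1C : `|z| < 1 by rewrite cmod_lt1.
  have h3 := PhiC z1C (hardy_eval f z).
  have h4 := ler_wpM2l C0 h2.
  have h5 : hnorm (T f) / (1 - cmod z) <= C * hnorm f / (1 - cmod z).
    by rewrite ler_wpM2r// invr_ge0 ltW.
  apply: le_trans (lerD (le_trans h1 h5) (le_trans h3 h4)) _.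
  rewrite le_eqVlt; apply/orP; left; apply/eqP.
  by field; rewrite gt_eqF.
have Diter n : hnorm (D h) <= cmod z ^+ n * ((2 * C / (1 - cmod z)) * hnorm h).
  have -> : D h = z ^+ n *: D (iter n (@hback R E) h).
    elim: n => [|n IH]; first by rewrite expr0 scale1r.
    by rewrite IH Dback scalerA -exprSr.
  rewrite hnorm_scale cmodX ler_wpM2l ?exprn_ge0 ?cmod_ge0//.
  apply: le_trans (Dle _) _; rewrite ler_wpM2l ?hnorm_iter_back//.
  by rewrite divr_ge0 ?mulr_ge0// ltW.
apply/eqP; rewrite -subr_eq0; apply/eqP/hnorm_eq0/eqP.
rewrite eq_le hnorm_ge0 andbT; set K := _ * hnorm h in Diter.
have : (fun n => cmod z ^+ n * K) @ \oo --> 0 * K.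
  apply: cvgM; last exact: cvg_cst.
  by apply: cvg_expr; rewrite ger0_norm ?cmod_ge0.
rewrite mul0r => /cvgr_to_ge; apply; exact: nearW.
Qed.

(** Multipliers are unique by the identity theorem, so the choice made in the
    definition of [toeplitz] is the one constructed. *)
Lemma toeplitz_spec (h : hardy E) : hnorm (toeplitz Phi h) <= C * hnorm h /\
  forall z, cmod z < 1 -> hardy_eval (toeplitz Phi h) z = Phi z (hardy_eval h z).
Proof.
have [g gC gPhi] := multiplier_exists h.
rewrite /toeplitz /mul_op; case: xgetP => [g' _ /= g'Phi|/(_ g)]; last first.
  by case=> z; rewrite cmod_lt1; exact: gPhi.
have -> : g' = g; last by [].
by apply: hardy_eval_inj => z z1; rewrite g'Phi ?gPhi// cmod_lt1.
Qed.

End Toeplitz.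

Section HinftyToeplitz.
Context (R : realType).
Implicit Types E F : hilbertType R.

Lemma Hinfty_bound E F (Phi : R[i] -> {linear E -> F}) : Hinfty Phi ->
  exists2 C : R, 0 <= C &
    forall z, `|z| < 1 -> forall x, hnorm (Phi z x) <= C * hnorm x.
Proof.
move=> [[C PhiC] _]; exists `|C| => // z z1 x.
apply: le_trans (PhiC z z1 x) _.
by rewrite ler_wpM2r ?hnorm_ge0// ler_norm.
Qed.

(** Identities between Toeplitz operators are proved through this lemma, as
    identities between values in the disc. *)
Lemma toeplitz_eval E F (Phi : R[i] -> {linear E -> F}) h z : Hinfty Phi ->
  cmod z < 1 -> hardy_eval (toeplitz Phi h) z = Phi z (hardy_eval h z).
Proof.
by move=> HPhi; have [C C0 PhiC] := Hinfty_bound HPhi;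
  apply: (toeplitz_spec C0 PhiC HPhi.2 h).2.
Qed.

Lemma toeplitz_lin E F (Phi : R[i] -> {linear E -> F}) (c : R[i]) f g :
  Hinfty Phi ->
  toeplitz Phi (c *: f + g) = c *: toeplitz Phi f + toeplitz Phi g.
Proof.
move=> HPhi; apply: hardy_eval_inj => z z1.
by rewrite toeplitz_eval// !hardy_eval_lin// !toeplitz_eval// linearP.
Qed.

Lemma toeplitz_bounded E F (Phi : R[i] -> {linear E -> F}) :
  Hinfty Phi -> bounded_op (toeplitz Phi).
Proof.
move=> HPhi; have [C C0 PhiC] := Hinfty_bound HPhi; exists C => h.
exact: (toeplitz_spec C0 PhiC HPhi.2 h).1.
Qed.

Lemma toeplitz_shift E F (Phi : R[i] -> {linear E -> F}) h :
  Hinfty Phi -> toeplitz Phi (hshift h) = hshift (toeplitz Phi h).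
Proof.
move=> HPhi; apply: hardy_eval_inj => z z1.
by rewrite toeplitz_eval// !hardy_eval_shift// toeplitz_eval// linearZ.
Qed.

Lemma hardy_eval_iter_shift E k (h : hardy E) z : cmod z < 1 ->
  hardy_eval (iter k (@hshift R E) h) z = z ^+ k *: hardy_eval h z.
Proof.
move=> z1; elim: k => [|k IH]; first by rewrite expr0 scale1r.
by rewrite /= hardy_eval_shift// IH scalerA exprS.
Qed.

Lemma mulzE E k (h : hardy E) : mulz k h = iter k (@hshift R E) h.
Proof.
rewrite /mulz /mul_op; case: xgetP => [g _ /= gE|/(_ (iter k (@hshift R E) h))].
  apply: hardy_eval_inj => z z1.
  by rewrite gE ?cmod_lt1// hardy_eval_iter_shift.
by case=> z; rewrite cmod_lt1 => z1; exact: hardy_eval_iter_shift.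
Qed.

Lemma iter_shift_coef_lt E k (h : hardy E) n : (n < k)%N ->
  iter k (@hshift R E) h n = 0.
Proof. by elim: k n => // k IH [|n]//= nk; rewrite IH. Qed.

Lemma iter_back_shift E k (h : hardy E) :
  iter k (@hback R E) (iter k (@hshift R E) h) = h.
Proof. by elim: k h => // k IH h; rewrite iterSr/= hback_shift IH. Qed.

Lemma linear_bounded_lipschitz E F (T : E -> F) :
  (forall (a : R[i]) x y, T (a *: x + y) = a *: T x + T y) -> bounded_op T ->
  exists C : R, forall x y, hnorm (T x - T y) <= C * hnorm (x - y).
Proof.
move=> Tlin [C TC]; exists C => x y.
have -> : T x - T y = T (x - y); last exact: TC.
by rewrite addrC -scaleN1r -Tlin scaleN1r addrC.
Qed.

Lemma closed_zero E : closed [set (0 : E)].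
Proof.
apply/hclosedP => x x0 /=; apply: hnorm_eq0; apply/eqP.
rewrite eq_le hnorm_ge0 andbT; apply/ler_addgt0Pl => e e0; rewrite addr0.
by have [y ->] := x0 e e0; rewrite subr0 => /ltW.
Qed.

Lemma hardy_poly_coef E k (x : 'I_k -> E) (i : 'I_k) : hardy_poly x i = x i.
Proof. by rewrite /= valK. Qed.

Lemma hardy_poly_coef_ge E k (x : 'I_k -> E) n : (k <= n)%N -> hardy_poly x n = 0.
Proof. by move=> kn; rewrite /= insubN// -leqNgt. Qed.

Lemma truncated_shift_coef E k (f : hardy E) (i : 'I_k) :
  truncated_shift (fun j : 'I_k => f j) i = hshift f i.
Proof.
rewrite /truncated_shift; case: i => -[|i] ik //=; congr (f _).
by rewrite modnDr modn_small// ltnW.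
Qed.

End HinftyToeplitz.

(** * Factorizations of z^k yield invariant subspaces *)

Section Backward.
Context (R : realType) (k : nat) (E F : hilbertType R).
Context (Theta : R[i] -> {linear F -> E}) (Phi : R[i] -> {linear E -> F}).
Context (HTheta : Hinfty Theta) (HPhi : Hinfty Phi).
Context (factor : toeplitz Theta \o toeplitz Phi = @mulz R E k).

Lemma toeplitz_comp_shift h :
  toeplitz Theta (toeplitz Phi h) = iter k (@hshift R E) h.
Proof. by rewrite -mulzE -factor. Qed.

(** With A = T_Phi, B = T_Theta and S the backward shift, S^k B is a left inverse
    of A, so the range of A is the fixed set of A S^k B, the kernel of the bounded
    operator A S^k B - 1. It is therefore closed, and f can be projected
    onto it. *)
Lemma toeplitz_range_decomp (f : hardy F) : exists h u,
  f = toeplitz Phi h + u /\ nullspace (adjoint (toeplitz Phi)) u.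
Proof.
pose A := toeplitz Phi; pose B := toeplitz Theta.
pose bk := iter k (@hback R E).
have bk_lin c g h : bk (c *: g + h) = c *: bk g + bk h.
  by rewrite /bk; elim: k => //= n ->; rewrite linearP.
have Alin c g h : A (c *: g + h) = c *: A g + A h by exact: toeplitz_lin.
have A0 : A 0 = 0.
  by have := Alin (-1) 0 0; rewrite !scaleN1r !addNr.
pose T v := A (bk (B v)) - v.
have Tlin c g h : T (c *: g + h) = c *: T g + T h.
  by rewrite /T /B toeplitz_lin// bk_lin Alin opprD addrACA -scalerBr.
have Tb : bounded_op T.
  have [a Aa] := toeplitz_bounded HPhi; have [b Bb] := toeplitz_bounded HTheta.
  exists (`|a| * `|b| + 1) => v; apply: le_trans (Defs.hnormD _ _) _.
  rewrite hnorm_opp mulrDl mul1r lerD2r.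
  apply: le_trans (Aa _) _; rewrite -mulrA.
  apply: (@le_trans _ _ (`|a| * hnorm (bk (B v)))).
    by rewrite ler_wpM2r ?hnorm_ge0// ler_norm.
  rewrite ler_wpM2l//; apply: le_trans (hnorm_iter_back _ _) _.
  by apply: le_trans (Bb v) _; rewrite ler_wpM2r ?hnorm_ge0// ler_norm.
have [D TD] := linear_bounded_lipschitz Tlin Tb.
have T0 : T 0 = 0.
  by have := Tlin (-1) 0 0; rewrite !scaleN1r !addNr.
have [|c g h Tg Th|p Tp port] := orthogonal_projection _ _
    (lipschitz_closed_preimage TD (@closed_zero _ _)) f.
- exact: T0.
- by rewrite /preimage/= in Tg Th *; rewrite Tlin Tg Th scaler0 addr0.
exists (bk (B p)), (f - p); split.
  by move/eqP: Tp; rewrite subr_eq0 -/A => /eqP ->; rewrite addrC subrK.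
rewrite nullspace_adjointP; last exact: toeplitz_bounded.
  move=> h; rewrite hdotC port ?rmorph0//=.
  by rewrite /T /B toeplitz_comp_shift /bk iter_back_shift subrr.
by move=> c g h; exact: toeplitz_lin.
Qed.

Lemma model_space_invariant (M : set ('I_k -> E)) :
  [set hardy_poly x | x in M] =
    [set toeplitz Theta g | g in nullspace (adjoint (toeplitz Phi))] ->
  forall x, M x -> M (truncated_shift x).
Proof.
move=> ME x Mx.
have [g gN gx] : [set toeplitz Theta g | g in nullspace (adjoint (toeplitz Phi))]
    (hardy_poly x) by rewrite -ME; exists x.
have [h [u [gE uN]]] := toeplitz_range_decomp (hshift g).
have [y My yu] : [set hardy_poly x | x in M] (toeplitz Theta u).
  by rewrite ME; exists u.
suff -> : truncated_shift x = y by [].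
have -> : x = (fun i : 'I_k => hardy_poly x i).
  by apply/funext => i; rewrite hardy_poly_coef.
apply/funext => i; rewrite truncated_shift_coef -gx -toeplitz_shift// gE.
rewrite -[toeplitz Phi h]scale1r toeplitz_lin// -yu toeplitz_comp_shift.
rewrite -[LHS]/(1 *: iter k (@hshift R E) h i + hardy_poly y i).
by rewrite iter_shift_coef_lt// scaler0 add0r hardy_poly_coef.
Qed.

End Backward.

(** * Contractive polynomial factors of z^k *)

Section PolynomialOperators.
Context (R : realType) (E : hilbertType R).
Implicit Types (Phi Psi : R[i] -> {linear E -> E}) (z : R[i]).

Definition op_polynomial Phi := exists n (A : nat -> {linear E -> E}),
  (forall j, bounded_op (A j)) /\
  forall z x, Phi z x = \sum_(0 <= j < n) z ^+ j *: A j x.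

Lemma bounded_op0 : bounded_op (\0 : {linear E -> E}).
Proof. by exists 0 => x; rewrite /= hnorm0 mul0r. Qed.

Lemma bounded_op_id : bounded_op (idfun : {linear E -> E}).
Proof. by exists 1 => x; rewrite /= mul1r. Qed.

(** The coefficient of z^m in the product of two operator polynomials with n and
    M terms. *)
Definition antidiagonal_op (A B : nat -> {linear E -> E}) n M m (x : E) : E :=
  \sum_(0 <= j < n) \sum_(0 <= l < M | (j + l)%N == m) A j (B l x).

Lemma antidiagonal_op_linear A B n M m : linear (antidiagonal_op A B n M m).
Proof.
move=> c x y; rewrite /antidiagonal_op scaler_sumr -big_split/=.
apply: eq_bigr => j _; rewrite scaler_sumr -big_split/=.
by apply: eq_bigr => l _; rewrite !linearP.
Qed.

HB.instance Definition _ A B n M m := GRing.isLinear.Build _ _ _ _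
  (antidiagonal_op A B n M m) (@antidiagonal_op_linear A B n M m).

Lemma bounded_op_sum (I : Type) (s : seq I) (P : pred I) (T : I -> E -> E) :
  (forall i, bounded_op (T i)) -> bounded_op (fun x => \sum_(i <- s | P i) T i x).
Proof.
move=> Tb; elim: s => [|i s [C TC]].
  by exists 0 => x; rewrite big_nil hnorm0 mul0r.
have [D TD] := Tb i; exists (`|D| + `|C|) => x; rewrite big_cons mulrDl.
have h1 : hnorm (T i x) <= `|D| * hnorm x.
  by apply: le_trans (TD x) _; rewrite ler_wpM2r ?hnorm_ge0// ler_norm.
have h2 : hnorm (\sum_(j <- s | P j) T j x) <= `|C| * hnorm x.
  by apply: le_trans (TC x) _; rewrite ler_wpM2r ?hnorm_ge0// ler_norm.
case: ifP => _; last by rewrite (le_trans h2)// lerDr mulr_ge0 ?hnorm_ge0.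
by apply: le_trans (Defs.hnormD _ _) _; exact: lerD.
Qed.

Lemma bounded_op_comp (S T : E -> E) :
  bounded_op S -> bounded_op T -> bounded_op (S \o T).
Proof.
move=> [C SC] [D TD]; exists (`|C| * `|D|) => x.
apply: le_trans (SC _) _; rewrite -mulrA.
apply: (@le_trans _ _ (`|C| * hnorm (T x))).
  by rewrite ler_wpM2r ?hnorm_ge0// ler_norm.
rewrite ler_wpM2l//; apply: le_trans (TD x) _.
by rewrite ler_wpM2r ?hnorm_ge0// ler_norm.
Qed.

Lemma op_polynomial_id : op_polynomial (fun=> idfun).
Proof.
exists 1%N, (fun=> idfun); split=> [_|z x]; first exact: bounded_op_id.
by rewrite big_nat1 expr0 scale1r.
Qed.

Lemma op_polynomial_comp Phi Psi : op_polynomial Phi -> op_polynomial Psi ->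
  op_polynomial (fun z => Phi z \o Psi z).
Proof.
move=> [n [A [Ab PhiA]]] [M [B [Bb PsiB]]].
exists (n + M)%N, (fun m => antidiagonal_op A B n M m); split=> [m|z x].
  apply: bounded_op_sum => j; apply: bounded_op_sum => l.
  exact: bounded_op_comp.
rewrite /= PsiB PhiA -(sum_antidiagonal _ (fun j l => A j (B l x))).
apply: eq_bigr => j _; rewrite linear_sum scaler_sumr.
by apply: eq_bigr => l _; rewrite linearZ/= scalerA exprD.
Qed.

Definition disc_contractive Phi :=
  forall z, cmod z <= 1 -> forall x, hnorm (Phi z x) <= hnorm x.

Lemma op_polynomial_Hinfty Phi :
  op_polynomial Phi -> disc_contractive Phi -> Hinfty Phi.
Proof.
move=> [n [A [Ab PhiA]]] PhiC; split.
  by exists 1 => z; rewrite cmod_lt1 => /ltW z1 x; rewrite mul1r; exact: PhiC.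
exists (fun j => if (j < n)%N then A j else \0) => [j|z z1 e e0].
  by case: ifP => _; [exact: Ab|exact: bounded_op0].
exists n => // m /= nm x.
rewrite (_ : Phi z x - _ = 0) ?hnorm0 ?mulr_ge0 ?hnorm_ge0 ?ltW//.
apply/eqP; rewrite subr_eq0 PhiA; apply/eqP.
rewrite [RHS](big_cat_nat (leq0n n) nm)/= [X in _ + X]big_nat.
rewrite [X in _ + X]big1 ?addr0; last first.
  by move=> j /andP[nj _]; rewrite ltnNge nj/= scaler0.
by rewrite big_nat [RHS]big_nat; apply: eq_bigr => j /andP[_ ->].
Qed.

(** By polarization the norm determines the inner product. *)
Lemma isometry_dot (E1 F : hilbertType R) (T : E1 -> F) :
  (forall (a : R[i]) x y, T (a *: x + y) = a *: T x + T y) ->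
  (forall x, hnorm (T x) = hnorm x) -> forall x y, '[T x, T y] = '[x, y].
Proof.
move=> Tlin Tiso x y; rewrite (hdot_polar (T x)) (hdot_polar x).
have H c : '[T x + c *: T y, T x + c *: T y] = '[x + c *: y, x + c *: y].
  by rewrite addrC -Tlin -!hnorm_sqrE Tiso addrC.
by rewrite !H.
Qed.

Lemma cmod_expi (t : R) : cmod (cos t +i* sin t) = 1.
Proof.
by apply: complexI; rewrite -cmodE normc_def/= cos2Dsin2 sqrtr1.
Qed.

Lemma radial_cvg (v : E) j : ((r%:C : R[i]) ^+ j) *: v @[r --> 1^'-] --> v.
Proof.
apply/hcvgP => e e0.
have : `|1 - r ^+ j| * hnorm v @[r --> 1^'-] --> `|1 - 1 ^+ j| * hnorm v.
  apply: cvg_at_left_filter; apply: cvgM; last exact: cvg_cst.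
  by apply: cvg_norm; apply: cvgB; [exact: cvg_cst|exact: exprn_continuous].
rewrite expr1n subrr normr0 mul0r => /cvgrPdist_lt/(_ e e0).
apply: filterS => r; rewrite sub0r normrN => re.
rewrite -{1}[v]scale1r -scalerBl hnorm_scale -rmorphXn/= -(rmorph1 (@real_complex R)).
by rewrite -rmorphB/= cmod_real; apply: le_lt_trans re; exact: ler_norm.
Qed.

Lemma op_polynomial_boundary Phi t : op_polynomial Phi ->
  boundary_value Phi t (Phi (cos t +i* sin t)).
Proof.
move=> [n [A [Ab PhiA]]] x; rewrite PhiA; under eq_fun do rewrite PhiA.
apply: (@cvg_big E nat _ 0 xpredT); first exact: add_continuous.
move=> j _; under eq_fun do rewrite exprMn -scalerA.
exact: radial_cvg.
Qed.

(** A polynomial is its own radial limit on the circle, so inner-ness can be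
    checked at every point of it. *)
Lemma op_polynomial_inner Phi : op_polynomial Phi -> disc_contractive Phi ->
  (forall z x, cmod z = 1 -> hnorm (Phi z x) = hnorm x) -> inner_function Phi.
Proof.
move=> Phip PhiC Phi1; apply: aeW => t _.
set z := cos t +i* sin t; have z1 : cmod z = 1 by exact: cmod_expi.
have Ub : bounded_op (Phi z) by exists 1 => x; rewrite mul1r PhiC// z1.
exists (Phi z); split=> // [|x]; first exact: op_polynomial_boundary.
apply/eqP; rewrite -subr_eq0; apply/eqP; set y := _ - x.
apply/eqP; rewrite -(@dnorm_eq0 _ _ hdot) {2}/y linearBr/= subr_eq0.
rewrite -adjointP//; last by move=> a u v; rewrite linearP.
by rewrite isometry_dot// => *; [rewrite linearP|exact: Phi1].
Qed.

(** Both products are required to be z^k. For infinite-dimensional E neither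
    condition implies the other (take for Theta a non-unitary co-isometry and for
    Phi its adjoint times z); Theta is isometric on the circle by the second
    one, and Phi by the first. *)
Definition inner_factorization (k : nat) Theta Phi :=
  [/\ op_polynomial Theta /\ disc_contractive Theta,
      op_polynomial Phi /\ disc_contractive Phi,
      (forall z x, Theta z (Phi z x) = z ^+ k *: x) &
      (forall z x, Phi z (Theta z x) = z ^+ k *: x)].

Lemma inner_factorization_sym k Theta Phi :
  inner_factorization k Theta Phi -> inner_factorization k Phi Theta.
Proof. by case. Qed.

(** |x| = |Phi(z) Theta(z) x| <= |Theta(z) x| <= |x| when |z| = 1. *)
Lemma factorization_isometric k Theta Phi : inner_factorization k Theta Phi ->
  forall z x, cmod z = 1 -> hnorm (Theta z x) = hnorm x.
Proof.
move=> [[_ TC] [_ PC] _ PT] z x z1; apply/le_anti/andP; split.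
  by apply: TC; rewrite z1.
have : hnorm (Phi z (Theta z x)) <= hnorm (Theta z x) by apply: PC; rewrite z1.
by rewrite PT hnorm_scale cmodX z1 expr1n mul1r.
Qed.

Lemma factorization_Hinfty k Theta Phi : inner_factorization k Theta Phi ->
  Hinfty Theta /\ inner_function Theta.
Proof.
move=> TP; have TI := factorization_isometric TP; case: TP => -[Tp TC] _ _ _.
by split; [exact: op_polynomial_Hinfty|exact: op_polynomial_inner].
Qed.

Lemma factorization_toeplitz k Theta Phi (h : hardy E) :
  inner_factorization k Theta Phi ->
  toeplitz Theta (toeplitz Phi h) = iter k (@hshift R E) h.
Proof.
move=> TP; have [HT _] := factorization_Hinfty TP.
have [HP _] := factorization_Hinfty (inner_factorization_sym TP).
apply: hardy_eval_inj => z z1; rewrite !toeplitz_eval// hardy_eval_iter_shift//.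
by case: TP => _ _ -> _.
Qed.

Lemma hnorm_iter_shift k (h : hardy E) : hnorm (iter k (@hshift R E) h) = hnorm h.
Proof. by elim: k => //= k <-; rewrite hnorm_shift. Qed.

Lemma toeplitz_contraction Phi (h : hardy E) :
  op_polynomial Phi -> disc_contractive Phi -> hnorm (toeplitz Phi h) <= hnorm h.
Proof.
move=> Phip PhiC; have [_ Phi_an] := op_polynomial_Hinfty Phip PhiC.
rewrite -[leRHS]mul1r; apply: (toeplitz_spec ler01 _ Phi_an h).1 => z.
by rewrite cmod_lt1 => /ltW z1 x; rewrite mul1r; exact: PhiC.
Qed.

(** The same squeeze for the operators: T_Phi T_Theta = z^k is isometric and both
    factors are contractions. *)
Lemma factorization_toeplitz_isometric k Theta Phi (h : hardy E) :
  inner_factorization k Theta Phi -> hnorm (toeplitz Theta h) = hnorm h.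
Proof.
move=> TP; have PTh := factorization_toeplitz h (inner_factorization_sym TP).
case: TP => -[Tp TC] [Pp PC] _ _; apply/le_anti/andP; split.
  exact: toeplitz_contraction.
by rewrite -[leLHS](hnorm_iter_shift k) -PTh; exact: toeplitz_contraction.
Qed.

Lemma inner_factorization_id : inner_factorization 0 (fun=> idfun) (fun=> idfun).
Proof.
by split; try (by move=> z x; rewrite expr0 scale1r);
  split=> //; exact: op_polynomial_id.
Qed.

Lemma inner_factorization_comp j k Theta1 Phi1 Theta2 Phi2 :
  inner_factorization j Theta1 Phi1 -> inner_factorization k Theta2 Phi2 ->
  inner_factorization (j + k) (fun z => Theta1 z \o Theta2 z)
    (fun z => Phi2 z \o Phi1 z).
Proof.
move=> [[T1p T1C] [P1p P1C] TP1 PT1] [[T2p T2C] [P2p P2C] TP2 PT2]; split.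
- split; first exact: op_polynomial_comp.
  by move=> z z1 x /=; apply: le_trans (T1C z z1 _) (T2C z z1 x).
- split; first exact: op_polynomial_comp.
  by move=> z z1 x /=; apply: le_trans (P2C z z1 _) (P1C z z1 x).
- by move=> z x /=; rewrite TP2 linearZ/= TP1 scalerA -exprD addnC.
- by move=> z x /=; rewrite PT1 linearZ/= PT2 scalerA -exprD.
Qed.

End PolynomialOperators.

(** * Potapov factors *)

Section Potapov.
Context (R : realType) (E : hilbertType R) (L : set E).
Context (L0 : L 0) (Llin : forall a x y, L x -> L y -> L (a *: x + y)).
Context (Lcl : closed L).

(** The defect of linearity of the projection is in L and orthogonal to L. *)
Lemma linear_projection : exists P : {linear E -> E},
  (forall x, L (P x)) /\ forall x l, L l -> '[x - P x, l] = 0.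
Proof.
have [p pP] : {p : E -> E & forall x, L (p x) /\ forall l, L l -> '[x - p x, l] = 0}.
  apply: (@choice _ _ (fun x q => L q /\ forall l, L l -> '[x - q, l] = 0)) => x.
  by have [q Lq qort] := orthogonal_projection L0 Llin Lcl x; exists q.
have plin : linear p.
  move=> a x y; apply/eqP; rewrite -subr_eq0 -(@dnorm_eq0 _ _ hdot); apply/eqP.
  set d := _ - _.
  have Ld : L d.
    have -> : d = -1 *: (a *: p x + p y) + p (a *: x + y).
      by rewrite /d scaleN1r [RHS]addrC.
    apply: Llin; last exact: (pP _).1.
    by apply: Llin; exact: (pP _).1.
  have {1}-> : d = a *: (x - p x) + (y - p y) - (a *: x + y - p (a *: x + y)).
    by rewrite /d scalerBr addrACA -opprD opprB [RHS]addrC addrA subrK.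
  by rewrite linearBl/= linearDl/= linearZl_LR/= !(pP _).2// mulr0 addr0 subr0.
pose P := GRing.isLinear.Build _ _ _ _ p plin.
pose P' : {linear E -> E} := HB.pack p P.
by exists P'; split=> x; [exact: (pP x).1|exact: (pP x).2].
Qed.

(** With P the projection onto L and Q = 1 - P, take Theta = P + z Q and
    Phi = Q + z P. At z = 0 they are the projections P and Q, which is what lets
    the induction below divide by Theta. *)
Lemma potapov_factor : exists Theta Phi, inner_factorization 1 Theta Phi /\
  [/\ (forall x, L (Theta 0 x)) & (forall x, L x -> Phi 0 x = 0)].
Proof.
have [P [LP Port]] := linear_projection.
pose Q : {linear E -> E} := idfun \- P.
have QE x : Q x = x - P x by [].
have Pid x : L x -> P x = x.
  move=> Lx; apply/esym/eqP; rewrite -subr_eq0 -(@dnorm_eq0 _ _ hdot).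
  apply/eqP; apply: Port; rewrite addrC -scaleN1r; exact: Llin.
have PP x : P (P x) = P x by exact: Pid.
have PQ x : P (Q x) = 0 by rewrite QE linearB/= PP subrr.
have QP x : Q (P x) = 0 by rewrite QE PP subrr.
have QQ x : Q (Q x) = Q x by rewrite [LHS]QE PQ subr0.
have PD (c : R[i]) u v : P (u + c *: v) = P u + c *: P v.
  by rewrite linearD linearZ.
have QD (c : R[i]) u v : Q (u + c *: v) = Q u + c *: Q v.
  by rewrite linearD linearZ.
have pythagoras u v : hnorm (P u + Q v) ^+ 2 = hnorm (P u) ^+ 2 + hnorm (Q v) ^+ 2.
  by apply: hnorm_sqrD_orthogonal; exact: Port.
have PQb : bounded_op P /\ bounded_op Q.
  split; exists 1 => x; rewrite mul1r -ler_sqr ?nnegrE ?hnorm_ge0//.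
    have := pythagoras x x; rewrite QE subrKC => ->.
    by rewrite lerDl sqr_ge0.
  have := pythagoras x x; rewrite {1}QE subrKC => ->.
  by rewrite lerDr sqr_ge0.
have contr (a b : R[i]) x : cmod a <= 1 -> cmod b <= 1 ->
    hnorm (a *: P x + b *: Q x) <= hnorm x.
  move=> a1 b1; rewrite -ler_sqr ?nnegrE ?hnorm_ge0// -!linearZ/= pythagoras.
  have -> : hnorm x ^+ 2 = hnorm (P x) ^+ 2 + hnorm (Q x) ^+ 2.
    by rewrite -pythagoras QE subrKC.
  rewrite !linearZ/= !hnorm_scale !exprMn; apply: lerD.
    by rewrite ler_piMl ?sqr_ge0// exprn_ile1 ?cmod_ge0.
  by rewrite ler_piMl ?sqr_ge0// exprn_ile1 ?cmod_ge0.
exists (fun z => P \+ z \*: Q), (fun z => Q \+ z \*: P); split; last first.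
  split=> x /=; first by rewrite scale0r addr0.
  by move=> Lx; rewrite scale0r addr0 Pid// subrr.
split.
- split.
    exists 2%N, (fun j => if j is 0%N then P else Q); split.
      by case=> [|j]; case: PQb.
    by move=> z x; rewrite !big_nat_recl//= big_geq// addr0 expr0 scale1r expr1.
  move=> z z1 x; have := contr 1 z x; rewrite scale1r; apply=> //.
  by rewrite /cmod normr1.
- split.
    exists 2%N, (fun j => if j is 0%N then Q else P); split.
      by case=> [|j]; case: PQb.
    by move=> z x; rewrite !big_nat_recl//= big_geq// addr0 expr0 scale1r expr1.
  move=> z z1 x; have := contr z 1 x; rewrite scale1r addrC; apply=> //.
  by rewrite /cmod normr1.
- move=> z x; rewrite -[LHS]/(P (Q x + z *: P x) + z *: Q (Q x + z *: P x)).
  rewrite PD QD PQ QQ PP QP !scaler0 ?addr0 ?add0r -scalerDr.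
  by rewrite QE subrKC.
- move=> z x; rewrite -[LHS]/(Q (P x + z *: Q x) + z *: P (P x + z *: Q x)).
  rewrite PD QD PQ QQ PP QP !scaler0 ?addr0 ?add0r -scalerDr.
  by rewrite QE subrK.
Qed.

End Potapov.

(** * Invariant subspaces yield factorizations *)

Section Forward.
Context (R : realType) (E : hilbertType R).
Implicit Types (f g h : hardy E).

Lemma toeplitz_comp (Theta1 Theta2 : R[i] -> {linear E -> E}) (h : hardy E) :
  Hinfty Theta1 -> Hinfty Theta2 -> Hinfty (fun z => Theta1 z \o Theta2 z) ->
  toeplitz (fun z => Theta1 z \o Theta2 z) h =
  toeplitz Theta1 (toeplitz Theta2 h).
Proof. by move=> *; apply: hardy_eval_inj => z z1; rewrite !toeplitz_eval. Qed.

Lemma iter_shift_lin k (c : R[i]) f g : iter k (@hshift R E) (c *: f + g) =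
  c *: iter k (@hshift R E) f + iter k (@hshift R E) g.
Proof. by elim: k => //= k ->; rewrite linearP. Qed.

Lemma iter_shift_decomp k f : iter k (@hshift R E) f =
  iter k (@hshift R E) (hconst (f 0%N)) + iter k.+1 (@hshift R E) (hback f).
Proof.
rewrite {1}(hardy_decomp f) -[X in X + _]scale1r iter_shift_lin scale1r.
by rewrite iterSr.
Qed.

Lemma hdot_iter_shift k f g :
  '[iter k (@hshift R E) f, g] = '[f, iter k (@hback R E) g].
Proof. by elim: k g => // k IH g; rewrite [iter _ _ f]/= hdot_shift IH -iterSr. Qed.

(** One Potapov factor T1 = P + z (1 - P) is split off per step, with P the
    projection onto L = {l : z^k l in S} when S contains z^(k+1) H^2. Evaluation
    at 0 maps S into L, because z^k f(0) = z^k f - z^(k+1) (f - f(0))/z is in S.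
    Hence for f in S the function w = T_P1 f, with P1 = (1 - P) + z P, vanishes at
    0, and T_T1 w = z f gives f = T_T1 (w/z): S lies in the range of T_T1. The
    preimage of S contains z^k H^2, because T1(0) has range in L. *)
Lemma shift_invariant_factorization k (S : set (hardy E)) :
  S 0 -> (forall (a : R[i]) f g, S f -> S g -> S (a *: f + g)) -> closed S ->
  (forall f, S f -> S (hshift f)) ->
  (forall f, S (iter k (@hshift R E) f)) ->
  exists Theta Phi : R[i] -> {linear E -> E},
    inner_factorization k Theta Phi /\ S = range (toeplitz Theta).
Proof.
elim: k S => [|k IH] S S0 Slin Scl Sshift Sk.
  exists (fun=> idfun), (fun=> idfun); split; first exact: inner_factorization_id.
  have [HT _] := factorization_Hinfty (@inner_factorization_id _ E).
  apply/seteqP; split=> f _; last exact: Sk.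
  by exists f => //; apply: hardy_eval_inj => z z1; rewrite toeplitz_eval.
have Siter n f : S f -> S (iter n (@hshift R E) f).
  by move=> Sf; elim: n => //= n; exact: Sshift.
pose L : set E := [set l | S (iter k (@hshift R E) (hconst l))].
pose J l := iter k (@hshift R E) (hconst l).
have Jlin (a : R[i]) x y : J (a *: x + y) = a *: J x + J y.
  by rewrite /J linearP iter_shift_lin.
have Jb : bounded_op J.
  by exists 1 => x; rewrite /J hnorm_iter_shift hnorm_const mul1r.
have [c Jc] := linear_bounded_lipschitz Jlin Jb.
have L0 : L 0 by rewrite /L/= linear0; exact: Siter.
have Llin (a : R[i]) x y : L x -> L y -> L (a *: x + y).
  by move=> Lx Ly; rewrite /L /= -/(J _) Jlin; exact: Slin.
have Lcl : closed L by exact: lipschitz_closed_preimage Jc Scl.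
have head f : S f -> L (f 0%N).
  move=> Sf; rewrite /L /=.
  have -> : iter k (@hshift R E) (hconst (f 0%N)) =
      -1 *: iter k.+1 (@hshift R E) (hback f) + iter k (@hshift R E) f.
    by rewrite (iter_shift_decomp k f) scaleN1r addrC addrK.
  by apply: Slin; [exact: Sk|exact: Siter].
have [T1 [P1 [TP1 [T1L P1L]]]] := potapov_factor L0 Llin Lcl.
have [HT1 _] := factorization_Hinfty TP1.
have [HP1 _] := factorization_Hinfty (inner_factorization_sym TP1).
have T1lin (a : R[i]) f g : toeplitz T1 (a *: f + g) = a *: toeplitz T1 f + toeplitz T1 g.
  exact: toeplitz_lin.
have [d T1d] := linear_bounded_lipschitz T1lin (toeplitz_bounded HT1).
have T1iter n f :
    toeplitz T1 (iter n (@hshift R E) f) = iter n (@hshift R E) (toeplitz T1 f).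
  by elim: n => //= n <-; rewrite toeplitz_shift.
have head_eval Phi f : Hinfty Phi -> toeplitz Phi f 0%N = Phi 0 (f 0%N).
  move=> HPhi; rewrite -!hardy_eval0 toeplitz_eval//.
  by rewrite -cmod_lt1 normr0.
have [|||||T2 [P2 [TP2 S1E]]] := IH (toeplitz T1 @^-1` S).
- have := T1lin (-1) 0 0; rewrite !scaleN1r !addNr => T10.
  by rewrite /preimage/= T10.
- by move=> a f g Sf Sg; rewrite /preimage/= T1lin; exact: Slin.
- exact: lipschitz_closed_preimage T1d Scl.
- by move=> f Sf; rewrite /preimage/= toeplitz_shift//; exact: Sshift.
- move=> f; rewrite /preimage/= T1iter iter_shift_decomp.
  rewrite -[X in X + _]scale1r; apply: Slin; last exact: Sk.
  by rewrite head_eval//; exact: T1L.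
have [HT2 _] := factorization_Hinfty TP2.
have TP := inner_factorization_comp TP1 TP2.
have [HT _] := factorization_Hinfty TP.
exists (fun z => T1 z \o T2 z), (fun z => P2 z \o P1 z); split; first exact: TP.
apply/seteqP; split=> f; last first.
  move=> [g _ <-]; rewrite toeplitz_comp//.
  by have : (toeplitz T1 @^-1` S) (toeplitz T2 g); [rewrite S1E; exists g|].
move=> Sf; pose w := toeplitz P1 f.
have w0 : w = hshift (hback w).
  by rewrite {1}(hardy_decomp w) /w head_eval// P1L ?linear0 ?add0r//; exact: head.
have T1w : toeplitz T1 (hback w) = f.
  rewrite -[LHS]hback_shift -toeplitz_shift// -w0 (factorization_toeplitz f TP1).
  exact: hback_shift.
have : (toeplitz T1 @^-1` S) (hback w) by rewrite /preimage/= T1w.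
rewrite S1E => -[g _ gw]; exists g => //.
by rewrite toeplitz_comp// gw.
Qed.

(** The k first coefficients depend continuously on f, for the product topology
    on the target. *)
Lemma closed_coefs k (M : set ('I_k -> E)) :
  closed (M : set {ptws 'I_k -> E}) ->
  closed [set f : hardy E | M (fun i : 'I_k => f i)].
Proof.
move=> Mcl.
have phic : continuous (fun f : hardy E => (fun i : 'I_k => f i) : {ptws 'I_k -> E}).
  move=> f; apply/cvg_sup; first exact/fmap_filter/nbhs_filter.
  move=> i U.
  have /= -> := @nbhsE (initial_topology (fun x : 'I_k -> E => x i))
    (fun i : 'I_k => f i).
  case=> B [[D oD <- Dfi]] /filterS; apply; first exact/fmap_filter/nbhs_filter.
  have coef_cvg : (fun g : hardy E => g i) @ f --> f i.
    apply/(@hcvgP _ _ _ _ (nbhs_filter f)) => e e0; apply/nbhs_ballP.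
    exists (e%:C : R[i]) => /=; first by rewrite ltcR.
    move=> g; rewrite -ball_normE /ball_/= hnormE ltcR; apply: le_lt_trans.
    exact: (hnorm_coef_le (f - g) i).
  have Dn : nbhs (f i) D by exact: open_nbhs_nbhs.
  exact: (coef_cvg D Dn).
by move/continuous_closedP : phic => /(_ M Mcl).
Qed.

(** For S the series whose first k coefficients lie in M and S = ran T_Theta, the
    identity <T_Phi h, g> = <z^k h, T_Theta g> = <h, S^k T_Theta g>, with S^k here
    the k-fold backward shift, shows that the kernel of the adjoint of T_Phi
    consists of the g for which T_Theta g has degree less than k. *)
Lemma invariant_model_space k (M : set ('I_k -> E)) : closed_subspace M ->
  (forall x, M x -> M (truncated_shift x)) ->
  exists Theta Phi : R[i] -> {linear E -> E}, inner_factorization k Theta Phi /\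
    [set hardy_poly x | x in M] =
      [set toeplitz Theta g | g in nullspace (adjoint (toeplitz Phi))].
Proof.
move=> [M0 Mlin Mcl] Minv.
pose S := [set f : hardy E | M (fun i : 'I_k => f i)].
have Sshift f : S f -> S (hshift f).
  rewrite /S/= => /Minv; congr M; apply/funext => i; exact: truncated_shift_coef.
have Sk f : S (iter k (@hshift R E) f).
  rewrite /S/= (_ : (fun _ => _) = 0)//.
  by apply/funext => i; rewrite iter_shift_coef_lt.
have [|a f g Sf Sg|Theta [Phi [TP SE]]] :=
  @shift_invariant_factorization k S _ _ (closed_coefs Mcl) Sshift Sk.
- exact: M0.
- exact: (Mlin a _ _ Sf Sg).
have [HT _] := factorization_Hinfty TP.
have [HP _] := factorization_Hinfty (inner_factorization_sym TP).
exists Theta, Phi; split=> //.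
have Plin (a : R[i]) f g :
    toeplitz Phi (a *: f + g) = a *: toeplitz Phi f + toeplitz Phi g.
  exact: toeplitz_lin.
have dotE h g : '[toeplitz Phi h, g] = '[h, iter k (@hback R E) (toeplitz Theta g)].
  rewrite -hdot_iter_shift -(factorization_toeplitz h TP) isometry_dot//.
    by move=> *; exact: toeplitz_lin.
  by move=> u; exact: factorization_toeplitz_isometric TP.
rewrite nullspace_adjointP//; last exact: toeplitz_bounded.
apply/seteqP; split=> f.
  move=> [x Mx <-].
  have [g _ gx] : range (toeplitz Theta) (hardy_poly x).
    have xE : x = (fun i : 'I_k => hardy_poly x i).
      by apply/funext => i; rewrite hardy_poly_coef.
    by rewrite -SE; move: Mx; rewrite {1}xE.
  exists g => // h; rewrite dotE gx.
  suff -> : iter k (@hback R E) (hardy_poly x) = 0 by rewrite linear0r.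
  apply: hardy_ext => n; rewrite iter_hback_coef hardy_poly_coef_ge//.
  exact: leq_addl.
move=> [g gN <-].
have back0 : iter k (@hback R E) (toeplitz Theta g) = 0.
  by apply/eqP; rewrite -(@dnorm_eq0 _ _ hdot) -dotE gN.
exists (fun i : 'I_k => toeplitz Theta g i).
  by have : S (toeplitz Theta g) by rewrite SE; exists g.
apply: hardy_ext => n; have [nk|kn] := ltnP n k.
  exact: (hardy_poly_coef _ (Ordinal nk)).
by rewrite hardy_poly_coef_ge// -(subnK kn) -iter_hback_coef back0.
Qed.

End Forward.

Theorem theorem4p3 (R : realType) (k : nat) (hk : (1 <= k)%N)
    (E : hilbertType R) (sepE : separable E)
    (M : set ('I_k -> E)) (clM : closed_subspace M) :
  (forall x, M x -> M (truncated_shift x)) <->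
  exists F : hilbertType R, unitarily_isomorphic F E /\
  exists (Theta : R[i] -> {linear F -> E}) (Phi : R[i] -> {linear E -> F}),
    [/\ Hinfty Theta /\ inner_function Theta,
        Hinfty Phi /\ inner_function Phi,
        toeplitz Theta \o toeplitz Phi = @mulz R E k &
        [set hardy_poly x | x in M] =
          [set toeplitz Theta g | g in nullspace (adjoint (toeplitz Phi))]].
Proof.
split=> [Minv|]; last first.
  case=> F [_ [T [Phi [HTheta HPhi factor ME]]]].
  exact: model_space_invariant HTheta.1 HPhi.1 factor M ME.
have [T [Phi [TP ME]]] := invariant_model_space clM Minv.
exists E; split.
  by exists idfun; split=> //; exists idfun.
exists T, Phi; split=> //.
- exact: factorization_Hinfty TP.
- exact: factorization_Hinfty (inner_factorization_sym TP).
- by apply/funext => h; rewrite mulzE -(factorization_toeplitz h TP).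
Qed.
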